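(* Let $R=\bigoplus_{n\in\mathbb{N}_0}R_n$ be a standard graded Noetherian ring whose base ring $(R_0,\mathfrak{m}_0)$ is local, let $M$ be a finitely generated graded $R$-module, and let $c:=\mathrm{cd}(R_+,\mathfrak{m}_0R,M)=\sup\{i: H^{i}_{R_+,\mathfrak{m}_0R}(M)\neq 0\}$ (an integer). Assume that one of the following (equivalent) conditions holds: (a) for every finitely generated graded $R$-module $N$ and every $k\in\mathbb{N}_0$, $H^{k}_{R_+,\mathfrak{m}_0R}(N)_n=0$ for all $n\gg0$; (b) for every finitely generated graded $R$-module $N$, every $k\in\mathbb{N}_0$ and every $n\in\mathbb{Z}$, $H^{k}_{R_+,\mathfrak{m}_0R}(N)_n$ is a finitely generated $R_0$-module. Then the graded $R$-module $H^{c}_{R_+,\mathfrak{m}_0R}(M)$ is tame.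
   Context: All rings are commutative Noetherian with identity. ''Standard graded'' means that $R=\bigoplus_{n\in\mathbb{N}_0}R_n$ is generated as an $R_0$-algebra by finitely many elements of $R_1$; $R_+:=\bigoplus_{n\geq 1}R_n$. For ideals $I,J$ of $R$ and an $R$-module $M$, the $(I,J)$-torsion submodule is $\Gamma_{I,J}(M):=\{x\in M: I^nx\subseteq Jx \text{ for } n\gg 1\}$ (equivalently, $I^n\subseteq \mathrm{Ann}(x)+J$ for some $n$), and $H^i_{I,J}(-)$ is the $i$-th right derived functor of $\Gamma_{I,J}(-)$. If $I,J$ are homogeneous and $M$ is graded, then $H^i_{I,J}(M)$ is a graded $R$-module: take a resolution of $M$ by injective objects in the category of graded $R$-modules and homogeneous (degree $0$) homomorphisms, apply $\Gamma_{I,J}$ and take cohomology. $H^i_{I,J}(M)_n$ denotes the component of degree $n$, an $R_0$-module. A graded $R$-module $T=\bigoplus_{n\in\mathbb{Z}}T_n$ is called tame (or asymptotically gap free) if either $T_n=0$ for all $n\ll0$ or else $T_n\neq0$ for all $n\ll0$. *)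

(* Defs.v *)
From HB Require Import structures.
From mathcomp Require Import all_boot all_order all_algebra.
From mathcomp Require Import boolp classical_sets functions.
From mathcomp Require Import ring.

Set Implicit Arguments.
Unset Strict Implicit.
Unset Printing Implicit Defensive.

Import Order.TTheory GRing.Theory Num.Theory.

Local Open Scope classical_set_scope.
Local Open Scope ring_scope.

Definition is_subgroup (V : zmodType) (A : set V) : Prop :=
  A 0 /\ forall x y, A x -> A y -> A (x - y).

(* x is a finite sum of elements f i of A i, with pairwise distinct indices. *)
Definition homsum (I : eqType) (V : zmodType) (A : I -> set V) (x : V) : Prop :=
  exists (s : seq I) (f : I -> V),
    [/\ uniq s, forall i, A i (f i) & x = \sum_(i <- s) f i].

Definition independent (I : eqType) (V : zmodType) (A : I -> set V) : Prop :=
  forall (s : seq I) (f : I -> V), uniq s -> (forall i, A i (f i)) ->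
    \sum_(i <- s) f i = 0 -> forall i, i \in s -> f i = 0.

(* V is the internal direct sum of the subgroups A i. *)
Definition direct_sum (I : eqType) (V : zmodType) (A : I -> set V) : Prop :=
  [/\ forall i, is_subgroup (A i), forall x, homsum A x & independent A].

Section DirectSumTheory.
Variables (I : eqType) (V : zmodType).
Implicit Type A : I -> set V.

Lemma subgroupN (B : set V) x : is_subgroup B -> B x -> B (- x).
Proof. by move=> [B0 BB] Bx; rewrite -[- x]add0r; apply: BB. Qed.

Lemma subgroupD (B : set V) x y : is_subgroup B -> B x -> B y -> B (x + y).
Proof.
by move=> gB Bx By; rewrite -[y]opprK; apply: gB.2 => //; apply: subgroupN.
Qed.

Lemma subgroup_sum (B : set V) J (r : seq J) (P : pred J) (F : J -> V) :
  is_subgroup B -> (forall j, P j -> B (F j)) -> B (\sum_(j <- r | P j) F j).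
Proof.
move=> gB BF; apply: (big_ind B) => //; first exact: gB.1.
by move=> x y; apply: subgroupD.
Qed.

Lemma subgroupMn (B : set V) x n : is_subgroup B -> B x -> B (x *+ n).
Proof.
by move=> gB Bx; rewrite -[n]card_ord -sumr_const; apply: subgroup_sum.
Qed.

Lemma sum_support (s : seq I) (f : I -> V) (s' : seq I) : uniq s -> uniq s' ->
  {subset s <= s'} ->
  \sum_(i <- s) f i = \sum_(i <- s') (if i \in s then f i else 0).
Proof.
move=> us us' ss'; rewrite -big_mkcond -[RHS]big_filter; apply: perm_big.
apply: uniq_perm => //; first exact: filter_uniq.
move=> i; rewrite mem_filter; case: (boolP (i \in s)) => //= /ss' -> //.
Qed.

Lemma homsum1 A n x : (forall i, is_subgroup (A i)) -> A n x -> homsum A x.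
Proof.
move=> gA Ax; exists [:: n], (fun i => if i == n then x else 0); split=> //.
  by move=> i; case: eqP => [->|_] //; exact: (gA i).1.
by rewrite big_seq1 eqxx.
Qed.

Lemma homsum0 A : (forall i, is_subgroup (A i)) -> homsum A 0.
Proof.
move=> gA; exists [::], (fun=> 0); split=> //; last by rewrite big_nil.
by move=> i; exact: (gA i).1.
Qed.

Lemma homsumB A x y : (forall i, is_subgroup (A i)) ->
  homsum A x -> homsum A y -> homsum A (x - y).
Proof.
move=> gA [s [f [us Af ->]]] [t [g [ut Ag ->]]].
exists (undup (s ++ t)),
  (fun i => (if i \in s then f i else 0) - (if i \in t then g i else 0)).
split; first exact: undup_uniq.
  move=> i; apply: (gA i).2; case: ifP => // _; exact: (gA i).1.
rewrite big_split /= sumrN; congr (_ - _); apply: sum_support => //;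
  try exact: undup_uniq.
- by move=> i; rewrite mem_undup mem_cat => ->.
- by move=> i; rewrite mem_undup mem_cat => ->; rewrite orbT.
Qed.

Lemma homsum_subgroup A : (forall i, is_subgroup (A i)) ->
  is_subgroup (homsum A).
Proof. by move=> gA; split; [apply: homsum0 | move=> x y; apply: homsumB]. Qed.

Lemma direct_sum_proj A : direct_sum A -> exists p : I -> V -> V,
  [/\ forall n x y, p n (x - y) = p n x - p n y,
      forall n x, A n (p n x),
      forall n x, A n x -> p n x = x,
      forall n m x, A n x -> m != n -> p m x = 0 &
      forall x, exists2 s, uniq s & x = \sum_(n <- s) p n x].
Proof.
move=> [gA spA inA].
have A0 i : A i 0 by exact: (gA i).1.
pose dec x (sf : seq I * (I -> V)) := [/\ uniq sf.1, forall i, A i (sf.2 i),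
  forall i, i \notin sf.1 -> sf.2 i = 0 & x = \sum_(i <- sf.1) sf.2 i].
have exdec x : exists sf, dec x sf.
  have [s [f [us Af ->]]] := spA x.
  exists (s, fun i => if i \in s then f i else 0); split=> //=.
  - by move=> i; case: ifP.
  - by move=> i /negPf ->.
  - by apply: sum_support.
pose d x := projT1 (cid (exdec x)).
have dP x : dec x (d x) by exact: (projT2 (cid (exdec x))).
have dec_sub x t : uniq t -> {subset (d x).1 <= t} ->
    x = \sum_(i <- t) (d x).2 i.
  move=> ut st; have [us Af f0 xE] := dP x; rewrite {1}xE.
  rewrite (sum_support _ us ut st); apply: eq_bigr => i _.
  by case: ifPn => // /f0.
have uniqueness x s f : dec x (s, f) -> forall i, (d x).2 i = f i.
  move=> [/= us Af f0 xE] i.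
  pose t := undup (i :: s ++ (d x).1).
  have ut : uniq t by apply: undup_uniq.
  apply/eqP; rewrite -subr_eq0; apply/eqP.
  apply: (inA t (fun i => (d x).2 i - f i)) => //.
  - by move=> j; apply: (gA j).2 => //; case: (dP x).
  - rewrite sumrB -(dec_sub x) //; last first.
      by move=> j; rewrite mem_undup inE mem_cat => ->; rewrite !orbT.
    rewrite {1}xE (@sum_support s f t) //; last first.
      by move=> j; rewrite mem_undup inE mem_cat => ->; rewrite orbT.
    rewrite -sumrB big1 // => j _; case: ifPn; rewrite ?subrr // => /f0 ->.
    by rewrite subrr.
  - by rewrite mem_undup inE eqxx.
exists (fun n x => (d x).2 n); split.
- move=> n x y; apply: (uniqueness _ (undup ((d x).1 ++ (d y).1))
    (fun n => (d x).2 n - (d y).2 n)).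
  have [us Af f0 xE] := dP x; have [ut Ag g0 yE] := dP y.
  split=> //=; first exact: undup_uniq.
  + by move=> i; apply: (gA i).2.
  + by move=> i; rewrite mem_undup mem_cat negb_or => /andP [/f0 -> /g0 ->];
       rewrite subrr.
  + rewrite sumrB -!dec_sub ?undup_uniq //.
    * by move=> i; rewrite mem_undup mem_cat => ->; rewrite orbT.
    * by move=> i; rewrite mem_undup mem_cat => ->.
- by move=> n x; case: (dP x).
- move=> n x Ax.
  rewrite (uniqueness x [:: n] (fun i => if i == n then x else 0)) ?eqxx //.
  split=> //=.
  + by move=> i; case: eqP => [->|].
  + by move=> i; rewrite inE => /negPf ->.
  + by rewrite big_seq1 eqxx.
- move=> n m x Ax /negPf mn.
  rewrite (uniqueness x [:: n] (fun i => if i == n then x else 0)) ?mn //.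
  split=> //=.
  + by move=> i; case: eqP => [->|].
  + by move=> i; rewrite inE => /negPf ->.
  + by rewrite big_seq1 eqxx.
- by move=> x; exists (d x).1; case: (dP x).
Qed.

Lemma direct_sum_proj_additive A : direct_sum A ->
  exists p : I -> {additive V -> V},
  [/\ forall n x, A n (p n x),
      forall n x, A n x -> p n x = x,
      forall n m x, A n x -> m != n -> p m x = 0 &
      forall x, exists2 s, uniq s & x = \sum_(n <- s) p n x].
Proof.
move=> /direct_sum_proj [p [pB pA pE p0 psum]].
pose q n : {additive V -> V} :=
  HB.pack (p n) (GRing.isZmodMorphism.Build V V (p n) (pB n)).
by exists q.
Qed.

End DirectSumTheory.

Definition is_ideal (A : comNzRingType) (I : set A) : Prop :=
  [/\ I 0, forall x y, I x -> I y -> I (x + y)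
    & forall a x, I x -> I (a * x)].

Definition ideal_gen (A : comNzRingType) (S : set A) : set A :=
  [set x | forall I, is_ideal I -> S `<=` I -> I x].

Fixpoint ideal_exp (A : comNzRingType) (I : set A) (n : nat) : set A :=
  if n is n'.+1
  then ideal_gen [set z | exists x y, [/\ I x, ideal_exp I n' y & z = x * y]]
  else setT.

Definition noetherian (A : comNzRingType) : Prop :=
  forall I : set A, is_ideal I ->
    exists s : seq A, I = ideal_gen [set x | x \in s].

Definition maximal_ideal (A : comNzRingType) (m : set A) : Prop :=
  [/\ is_ideal m, m <> setT
    & forall I, is_ideal I -> m `<=` I -> I = m \/ I = setT].

Definition local_ring (A : comNzRingType) (m : set A) : Prop :=
  maximal_ideal m /\ forall m', maximal_ideal m' -> m' = m.

Section IdealTheory.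
Variable A : comNzRingType.
Implicit Types I J K : set A.

Lemma ideal_subgroup I : is_ideal I -> is_subgroup I.
Proof.
by move=> [I0 ID IM]; split=> // x y Ix Iy; apply: ID => //; rewrite -mulN1r;
  apply: IM.
Qed.

Lemma ideal_gen_ideal (S : set A) : is_ideal (ideal_gen S).
Proof.
split.
- by move=> I [].
- by move=> x y Sx Sy I iI SI; case: (iI) => _ ID _; apply: ID;
    [apply: Sx | apply: Sy].
- by move=> a x Sx I iI SI; case: (iI) => _ _ IM; apply: IM; apply: Sx.
Qed.

Lemma sub_ideal_gen (S : set A) : S `<=` ideal_gen S.
Proof. by move=> x Sx I _; apply. Qed.

Lemma ideal_exp_ideal I n : is_ideal (ideal_exp I n).
Proof. by case: n => [|n]; [split | apply: ideal_gen_ideal]. Qed.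

Lemma ideal_expS I n x y : I x -> ideal_exp I n y -> ideal_exp I n.+1 (x * y).
Proof. by move=> Ix Iy; apply: sub_ideal_gen; exists x, y. Qed.

Lemma ideal_exp_decr I m n : (m <= n)%N -> ideal_exp I n `<=` ideal_exp I m.
Proof.
move=> /subnK <-; elim: (n - m)%N => [//|k IH] x /= xI; apply: IH.
apply: xI; first exact: ideal_exp_ideal.
move=> _ [a [b [_ Ib ->]]]; case: (ideal_exp_ideal I (k + m)) => _ _; exact.
Qed.

Lemma ideal_colon K a : is_ideal K -> is_ideal [set b | K (a * b)].
Proof.
move=> [K0 KD KM]; split=> /=; first by rewrite mulr0.
- by move=> x y Kx Ky; rewrite mulrDr; apply: KD.
- by move=> b x Kx; rewrite mulrCA; apply: KM.
Qed.

Lemma ideal_expD I n m K : is_ideal K ->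
  (forall u v, ideal_exp I n u -> ideal_exp I m v -> K (u * v)) ->
  ideal_exp I (n + m) `<=` K.
Proof.
elim: n K => [|n IH] K iK HK; first by move=> v Iv;
  rewrite -[v]mul1r; apply: HK.
move=> x /= xI; apply: xI => // _ [a [b [Ia Ib ->]]].
apply: (IH [set b | K (a * b)]) Ib; first exact: ideal_colon.
by move=> u v Iu Iv /=; rewrite mulrA; apply: HK => //; apply: ideal_expS.
Qed.

Definition radical K : set A := [set x | exists n, K (x ^+ n)].

Lemma radical_ideal K : is_ideal K -> is_ideal (radical K).
Proof.
move=> iK; have [K0 KD KM] := iK; split.
- by exists 1%N; rewrite expr1.
- move=> x y [n Kx] [m Ky]; exists (n + m)%N; rewrite exprDn.
  apply: subgroup_sum => [|i _]; first exact: ideal_subgroup.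
  apply: subgroupMn; first exact: ideal_subgroup.
  have [le|/ltnW le] := leqP m i.
    by rewrite -(subnK le) exprD mulrA; apply: KM.
  have le' : (n <= n + m - i)%N by rewrite -addnBA // leq_addr.
  by rewrite -(subnK le') exprD mulrC mulrA; apply: KM.
- by move=> a x [n Kx]; exists n; rewrite exprMn; apply: KM.
Qed.

Lemma ideal_gen_cons a (s : seq A) x :
  ideal_gen [set y | y \in a :: s] x ->
  exists r y, ideal_gen [set z | z \in s] y /\ x = r * a + y.
Proof.
have [G0 GD GM] := ideal_gen_ideal [set z | z \in s].
move=> /(_ [set x | exists r y,
  ideal_gen [set z | z \in s] y /\ x = r * a + y]); apply.
- split.
  + by exists 0, 0; split => //; rewrite mul0r addr0.
  + move=> _ _ [r [y [Gy ->]]] [r' [y' [Gy' ->]]].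
    by exists (r + r'), (y + y'); split; [apply: GD | rewrite mulrDl addrACA].
  + move=> b _ [r [y [Gy ->]]].
    by exists (b * r), (b * y); split; [apply: GM | rewrite mulrDr mulrA].
- move=> z /=; rewrite inE => /orP [/eqP ->|zs].
    by exists 1, 0; rewrite mul1r addr0.
  by exists 0, z; rewrite mul0r add0r; split => //; apply: sub_ideal_gen.
Qed.

Lemma fg_radical_exp (s : seq A) K : is_ideal K ->
  (forall x, x \in s -> radical K x) ->
  exists N, ideal_exp (ideal_gen [set y | y \in s]) N `<=` K.
Proof.
elim: s K => [|a s IH] K iK sK.
  exists 1%N => x /= xE; apply: xE => // _ [u [v [Iu _ ->]]].
  have [K0 KD KM] := iK.
  rewrite mulrC; apply: KM; apply: Iu => //.
have [m Hm] : exists m, ideal_exp (ideal_gen [set y | y \in s]) m `<=` K.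
  by apply: IH => // x xs; apply: sK; rewrite inE xs orbT.
have [p Kp] : radical K a by apply: sK; rewrite inE eqxx.
set L := ideal_gen [set y | y \in a :: s].
set L' := ideal_gen [set y | y \in s] in Hm.
elim: p K iK Hm Kp {sK} => [|p IHp] K iK Hm Kp; have [K0 KD KM] := iK.
  by exists 0%N => x _; rewrite -[x]mulr1; apply: KM.
have [|||N1 HN1] := IHp [set b | K (a * b)].
- exact: ideal_colon.
- by move=> x /Hm; apply: KM.
- by rewrite /= -exprS.
have claim t : (t <= m)%N -> forall y v, ideal_exp L' (m - t) y ->
    ideal_exp L (t + N1) v -> K (y * v).
  elim: t => [|t IHt] tm y v.
    by rewrite subn0 => /Hm Ky _; rewrite mulrC; apply: KM.
  move=> Iy /(_ [set b | K (y * b)]) /=; apply; first exact: ideal_colon.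
  move=> _ [l [v' [Ll Lv' ->]]] /=.
  have [r [y' [Iy' ->]]] := ideal_gen_cons Ll.
  rewrite mulrDl mulrDr; apply: KD.
    have -> : y * (r * a * v') = y * r * (a * v') by rewrite !mulrA.
    apply: KM; apply: HN1; apply: ideal_exp_decr Lv'; exact: leq_addl.
  rewrite mulrA; apply: IHt => //; first exact: ltnW.
  by rewrite -[(m - t)%N](@prednK _) ?subn_gt0 // -subnS mulrC;
    apply: ideal_expS.
exists (m + N1)%N => v Lv; rewrite -[v]mul1r.
by apply: (claim m) => //; rewrite subnn.
Qed.

End IdealTheory.

Record noethGradedRing := NoethGradedRing {
  gr_ring :> comNzRingType;
  gr_piece : nat -> set gr_ring;
  gr_sum : direct_sum gr_piece;
  gr_one : gr_piece 0%N 1;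
  gr_mul : forall i j x y,
    gr_piece i x -> gr_piece j y -> gr_piece (i + j)%N (x * y);
  gr_noeth : noetherian gr_ring
}.
Arguments gr_piece : clear implicits.

Section BaseRing.
Variable R : noethGradedRing.

Definition base_pred : {pred R} := fun x => `[< gr_piece R 0%N x >].

Lemma base_pred_closed : subring_closed base_pred.
Proof.
have [gR _ _] := gr_sum R; split.
- by apply/asboolP; apply: gr_one.
- move=> x y /asboolP Rx /asboolP Ry; apply/asboolP.
  exact: (gR 0%N).2.
- move=> x y /asboolP Rx /asboolP Ry; apply/asboolP.
  exact: (gr_mul Rx Ry).
Qed.

HB.instance Definition _ := GRing.isSubringClosed.Build R base_pred
  base_pred_closed.

(* The degree 0 component, as a ring in its own right. *)
Definition base_ring : Type := {x : R | base_pred x}.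

HB.instance Definition _ := SubChoice.on base_ring.
HB.instance Definition _ := [SubChoice_isSubComNzRing of base_ring by <:].

End BaseRing.

(* The last clause says that the R_0-subalgebra generated by s is R; a subset B
   containing R_0 and closed under + and * is a subalgebra since -1 is in R_0. *)
Definition standard_graded (R : noethGradedRing) : Prop :=
  exists s : seq R, (forall x, x \in s -> gr_piece R 1%N x) /\
    forall B : set R, gr_piece R 0%N `<=` B -> (forall x, x \in s -> B x) ->
      (forall x y, B x -> B y -> B (x + y) /\ B (x * y)) -> B = setT.

Record grmod (R : noethGradedRing) := GrMod {
  gm_mod :> lmodType R;
  gm_piece : int -> set gm_mod;
  gm_sum : direct_sum gm_piece;
  gm_act : forall i n (a : R) x,
    gr_piece R i a -> gm_piece n x -> gm_piece (i%:Z + n) (a *: x)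
}.
Arguments gm_piece {R} M n : rename.

(* Homogeneous homomorphisms of degree 0. *)
Record grhom (R : noethGradedRing) (M N : grmod R) := GrHom {
  gh_fun :> {linear M -> N};
  gh_deg : forall n x, gm_piece M n x -> gm_piece N n (gh_fun x)
}.

Record submod (R : comNzRingType) (V : lmodType R) := Submod {
  sm_set :> V -> Prop;
  sm_0 : sm_set 0;
  sm_D : forall x y, sm_set x -> sm_set y -> sm_set (x + y);
  sm_Z : forall (a : R) x, sm_set x -> sm_set (a *: x)
}.

(* Homogeneous (graded) submodules. *)
Record hsubmod (R : noethGradedRing) (M : grmod R) := HSubmod {
  hs_submod :> submod M;
  hs_hom : forall x, hs_submod x ->
    homsum (fun n => [set y | hs_submod y /\ gm_piece M n y]) x
}.

Record hideal (R : noethGradedRing) := HIdeal {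
  hi_set :> R -> Prop;
  hi_ideal : is_ideal hi_set;
  hi_hom : forall x, hi_set x ->
    homsum (fun n => [set y | hi_set y /\ gr_piece R n y]) x
}.


Section SubmoduleType.
Variables (R : comNzRingType) (V : lmodType R).
Implicit Type S : submod V.

Lemma sm_subgroup S : is_subgroup S.
Proof.
split; first exact: sm_0.
by move=> x y Sx Sy; apply: sm_D => //; rewrite -scaleN1r; apply: sm_Z.
Qed.

Definition sm_pred S : {pred V} := fun x => `[< S x >].

Lemma sm_pred_closed S : subsemimod_closed (sm_pred S).
Proof.
split; first split.
- exact/asboolP/sm_0.
- by move=> x y /asboolP Sx /asboolP Sy; apply/asboolP; apply: sm_D.
- by move=> a x /asboolP Sx; apply/asboolP; apply: sm_Z.
Qed.

HB.instance Definition _ S :=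
  GRing.isSubmodClosed.Build R V (sm_pred S) (sm_pred_closed S).

Definition sub_type S : Type := {x : V | sm_pred S x}.
HB.instance Definition _ S := SubChoice.on (sub_type S).
HB.instance Definition _ S := [SubChoice_isSubLmodule of sub_type S by <:].

Lemma sub_typeP S (x : sub_type S) : S (val x).
Proof. by apply/asboolP; exact: (valP x). Qed.

Lemma sub_val0 S : val (0 : sub_type S) = 0.
Proof. by []. Qed.
Lemma sub_valB S (x y : sub_type S) : val (x - y) = val x - val y.
Proof. exact: (raddfB (val : sub_type S -> V)). Qed.
Lemma sub_valD S (x y : sub_type S) : val (x + y) = val x + val y.
Proof. exact: (raddfD (val : sub_type S -> V)). Qed.
Lemma sub_valZ S a (x : sub_type S) : val (a *: x) = a *: val x.
Proof. by []. Qed.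
Lemma sub_val_sum S I (r : seq I) (f : I -> sub_type S) :
  val (\sum_(i <- r) f i) = \sum_(i <- r) val (f i).
Proof. exact: (raddf_sum (val : sub_type S -> V)). Qed.

Definition to_sub S x (Sx : S x) : sub_type S := exist _ x (asboolT Sx).

Definition quot_type S : Type := Quotient.quot (sm_pred S).
HB.instance Definition _ S := GRing.Zmodule.on (quot_type S).

Definition quot_pi S (x : V) : quot_type S :=
  (\pi_(Quotient.quot (sm_pred S)) x)%qT.

Lemma quot_pi_zmod S : zmod_morphism (quot_pi S).
Proof. exact: (raddfB (\pi_(Quotient.quot (sm_pred S)))%qT). Qed.

HB.instance Definition _ S :=
  GRing.isZmodMorphism.Build V (quot_type S) (quot_pi S) (quot_pi_zmod S).

Lemma quot_piE S x y : quot_pi S x = quot_pi S y <-> S (x - y).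
Proof.
have -> : (quot_pi S x = quot_pi S y) = (x - y \in sm_pred S).
  by rewrite Quotient.idealrBE; apply/propext; split=> /eqP.
by split=> /asboolP.
Qed.

Lemma quot_pi_surj S (q : quot_type S) : exists x, quot_pi S x = q.
Proof. by exists (generic_quotient.repr q); exact: generic_quotient.reprK. Qed.

Definition quot_scale S (a : R) (q : quot_type S) : quot_type S :=
  quot_pi S (a *: generic_quotient.repr q).

Lemma quot_scaleE S a x : quot_scale a (quot_pi S x) = quot_pi S (a *: x).
Proof.
apply/quot_piE; rewrite -scalerBr; apply: sm_Z; apply/quot_piE.
exact: generic_quotient.reprK.
Qed.

Lemma quot_scaleA S a b (q : quot_type S) :
  quot_scale a (quot_scale b q) = quot_scale (a * b) q.
Proof. by have [x <-] := quot_pi_surj q; rewrite !quot_scaleE scalerA. Qed.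
Lemma quot_scale1 S : left_id 1 (@quot_scale S).
Proof.
by move=> q; have [x <-] := quot_pi_surj q; rewrite quot_scaleE scale1r.
Qed.
Lemma quot_scaleDr S : right_distributive (@quot_scale S) +%R.
Proof.
move=> a q q'; have [x <-] := quot_pi_surj q; have [y <-] := quot_pi_surj q'.
by rewrite -raddfD !quot_scaleE scalerDr raddfD.
Qed.
Lemma quot_scaleDl S (q : quot_type S) :
  {morph (@quot_scale S)^~ q : a b / a + b}.
Proof.
move=> a b; have [x <-] := quot_pi_surj q.
by rewrite !quot_scaleE scalerDl raddfD.
Qed.

HB.instance Definition _ S := GRing.Zmodule_isLmodule.Build R (quot_type S)
  (@quot_scaleA S) (@quot_scale1 S) (@quot_scaleDr S) (@quot_scaleDl S).

Lemma quot_pi_scalable S : scalable (quot_pi S).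
Proof. by move=> a x; rewrite -quot_scaleE. Qed.

HB.instance Definition _ S :=
  GRing.isScalable.Build R V (quot_type S) *:%R (quot_pi S) (@quot_pi_scalable S).

End SubmoduleType.

Section GradedTheory.
Variable R : noethGradedRing.
Implicit Types M N : grmod R.

(* A submodule S of V graded by the subgroups S `&` A n, where the A n are only
   independent, not spanning, in V. *)
Section Span.
Variables (V : lmodType R) (S : submod V) (A : int -> set V).
Hypothesis gA : forall n, is_subgroup (A n).
Hypothesis actA : forall i n (a : R) x,
  gr_piece R i a -> A n x -> A (i%:Z + n) (a *: x).
Hypothesis inA : independent A.
Hypothesis spA : forall x, S x -> homsum (fun n => [set y | S y /\ A n y]) x.

Let piece n : set (sub_type S) := [set x | A n (val x)].

Lemma span_sum : direct_sum piece.
Proof.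
split.
- move=> n; split; first exact: (gA n).1.
  by move=> x y Ax Ay; rewrite /piece /mkset sub_valB; apply: (gA n).2.
- move=> x; have [s [f [us Af xE]]] := spA (sub_typeP x).
  exists s, (fun i => to_sub (Af i).1); split=> //.
    by move=> i; exact: (Af i).2.
  by apply: val_inj; rewrite sub_val_sum.
- move=> s f us Af /(congr1 val); rewrite sub_val_sum sub_val0 => f0 i si.
  apply: val_inj; rewrite sub_val0.
  exact: (inA us Af f0).
Qed.

Lemma span_act i n (a : R) (x : sub_type S) :
  gr_piece R i a -> piece n x -> piece (i%:Z + n) (a *: x).
Proof. by move=> Ra Ax; rewrite /piece /mkset sub_valZ; apply: actA. Qed.

Definition span_grmod : grmod R := GrMod span_sum span_act.
End Span.

Lemma gm_proj M : exists p : int -> {additive M -> M},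
  [/\ forall n x, gm_piece M n (p n x),
      forall n x, gm_piece M n x -> p n x = x,
      forall n m x, gm_piece M n x -> m != n -> p m x = 0 &
      forall x, exists2 s, uniq s & x = \sum_(n <- s) p n x].
Proof. exact: direct_sum_proj_additive (gm_sum M). Qed.

Lemma gm_subgroup M n : is_subgroup (gm_piece M n).
Proof. by have [] := gm_sum M. Qed.

Lemma gm_independent M : independent (gm_piece M).
Proof. by have [] := gm_sum M. Qed.

Definition gsub M (S : hsubmod M) : grmod R :=
  span_grmod (gm_subgroup M) (@gm_act R M) (@gm_independent M) (@hs_hom R M S).

Lemma hs_proj M (S : hsubmod M) n x (p : int -> {additive M -> M}) :
  (forall n x, gm_piece M n x -> p n x = x) ->
  (forall n m x, gm_piece M n x -> m != n -> p m x = 0) ->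
  S x -> S (p n x).
Proof.
move=> pE p0 /hs_hom [s [f [us Sf ->]]].
rewrite raddf_sum; apply: subgroup_sum => [|i _]; first exact: sm_subgroup.
have [Si Mi] := Sf i; have [<-|/eqP ni] := i =P n; first by rewrite pE.
by rewrite (p0 i) //; [exact: sm_0 | rewrite eq_sym].
Qed.

Section Quotient.
Variables (M : grmod R) (S : hsubmod M).

Let piece n : set (quot_type S) :=
  [set q | exists2 x, gm_piece M n x & quot_pi S x = q].

Lemma quot_sum : direct_sum piece.
Proof.
split.
- move=> n; split; first by exists 0; rewrite ?raddf0 //; apply: (gm_subgroup M n).1.
  move=> _ _ [x Mx <-] [y My <-]; exists (x - y); rewrite ?raddfB //.
  exact: (gm_subgroup M n).2.
- move=> q; have [x <-] := quot_pi_surj q.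
  have [_ /(_ x) [s [f [us Mf ->]]] _] := gm_sum M.
  exists s, (fun i => quot_pi S (f i)); split=> //; last by rewrite raddf_sum.
  by move=> i; exists (f i).
- move=> s f us /(_ _)/cid2 Pf.
  pose g i := projT1 (Pf i).
  have Mg i : gm_piece M i (g i) by rewrite /g; case: (Pf i).
  have fE i : f i = quot_pi S (g i) by rewrite /g; case: (Pf i).
  under eq_bigr do rewrite fE.
  move=> sum0 i si; have Sg : S (\sum_(j <- s) g j).
    by rewrite -[X in S X]subr0; apply/quot_piE; rewrite raddf_sum raddf0.
  have [p [pM pE p0 _]] := gm_proj M.
  suff Sgi : S (g i).
    by rewrite fE -[RHS](raddf0 (quot_pi S)); apply/quot_piE; rewrite subr0.
  suff <- : p i (\sum_(i <- s) g i) = g i by exact: hs_proj.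
  rewrite raddf_sum (bigD1_seq i) //= pE // big1 ?addr0 // => j ji.
  by rewrite (p0 j) // eq_sym.
Qed.

Lemma quot_act i n (a : R) (q : quot_type S) :
  gr_piece R i a -> piece n q -> piece (i%:Z + n) (a *: q).
Proof.
by move=> Ra [x Mx <-]; exists (a *: x); rewrite ?linearZ //; apply: gm_act.
Qed.

Definition gquot : grmod R := GrMod quot_sum quot_act.
End Quotient.


Lemma proj_only M (W : zmodType) (h : {additive M -> W}) i
    (p : int -> {additive M -> M}) :
  [/\ forall n x, gm_piece M n (p n x),
      forall n x, gm_piece M n x -> p n x = x,
      forall n m x, gm_piece M n x -> m != n -> p m x = 0 &
      forall x, exists2 s, uniq s & x = \sum_(n <- s) p n x] ->
  (forall n x, gm_piece M n x -> n != i -> h x = 0) ->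
  forall x, h x = h (p i x).
Proof.
move=> [pM pE p0 ps] h0 x; have [s us xE] := ps x.
have hp j : j != i -> h (p j x) = 0 by apply: h0.
have pp j : i != j -> p i (p j x) = 0 by apply: p0.
rewrite {1}xE raddf_sum; have [si|si] := boolP (i \in s).
  by rewrite (bigD1_seq i) //= big1 ?addr0 // => j; apply: hp.
rewrite big1_seq => [|j /= sj]; last by apply: hp; apply: contraNneq si => <-.
rewrite xE raddf_sum big1_seq ?raddf0 // => j /= sj; apply: pp.
by apply: contraNneq si => ->.
Qed.

Lemma grhom_proj M N (f : grhom M N) i
    (p : int -> {additive M -> M}) (q : int -> {additive N -> N}) :
  [/\ forall n x, gm_piece M n (p n x),
      forall n x, gm_piece M n x -> p n x = x,
      forall n m x, gm_piece M n x -> m != n -> p m x = 0 &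
      forall x, exists2 s, uniq s & x = \sum_(n <- s) p n x] ->
  (forall n x, gm_piece N n x -> q n x = x) ->
  (forall n m x, gm_piece N n x -> m != n -> q m x = 0) ->
  forall x, f (p i x) = q i (f x).
Proof.
move=> pP qE q0 x; have -> : q i (f x) = q i (f (p i x)).
  apply: (proj_only (h := q i \o f) pP) => n y /(gh_deg f) Ny ni /=.
  by apply: q0 Ny _; rewrite eq_sym.
by rewrite qE //; apply: gh_deg; case: pP.
Qed.

Section Pre.
Variables (M N : grmod R) (f : grhom M N) (S : hsubmod N).

Let pre : set M := [set x | S (f x)].

Let pre0 : pre 0. Proof. by rewrite /pre /= raddf0; apply: sm_0. Qed.
Let preD x y : pre x -> pre y -> pre (x + y).
Proof. by rewrite /pre /= raddfD; apply: sm_D. Qed.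
Let preZ (a : R) x : pre x -> pre (a *: x).
Proof. by rewrite /pre /= linearZ; apply: sm_Z. Qed.

Lemma gpre_hom x : Submod pre0 preD preZ x ->
  homsum (fun n => [set y | Submod pre0 preD preZ y /\ gm_piece M n y]) x.
Proof.
move=> Sx; have [p pP] := gm_proj M; have [q [qN qE q0 _]] := gm_proj N.
have [pM _ _ /(_ x) [s us xE]] := pP.
exists s, (fun i => p i x); split=> // i; split=> //=.
by rewrite /pre /= (grhom_proj f i pP qE q0); apply: hs_proj.
Qed.

Definition gpre : hsubmod M := HSubmod gpre_hom.
End Pre.

Section Zero.
Variable M : grmod R.

Let zero : set M := [set 0].
Let zeroD x y : zero x -> zero y -> zero (x + y).
Proof. by rewrite /zero /= => -> ->; rewrite addr0. Qed.
Let zeroZ (a : R) x : zero x -> zero (a *: x).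
Proof. by rewrite /zero /= => ->; rewrite scaler0. Qed.

Lemma gzero_hom x : Submod (erefl : zero 0) zeroD zeroZ x ->
  homsum (fun n => [set y | Submod (erefl : zero 0) zeroD zeroZ y
                            /\ gm_piece M n y]) x.
Proof.
move=> -> ; apply: homsum0 => i; split; first by split=> //; apply: (gm_subgroup M i).1.
by move=> y z [-> My] [-> Mz]; rewrite subrr.
Qed.

Definition gzero : hsubmod M := HSubmod gzero_hom.
End Zero.

Definition gker M N (f : grhom M N) : hsubmod M := gpre f (gzero N).

Section Image.
Variables (M N : grmod R) (f : grhom M N).

Let im : set N := range f.

Let im0 : im 0. Proof. by exists 0; rewrite ?raddf0. Qed.
Let imD x y : im x -> im y -> im (x + y).
Proof. by move=> [u _ <-] [v _ <-]; exists (u + v); rewrite ?raddfD. Qed.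
Let imZ (a : R) x : im x -> im (a *: x).
Proof. by move=> [u _ <-]; exists (a *: u); rewrite ?linearZ. Qed.

Lemma gim_hom x : Submod im0 imD imZ x ->
  homsum (fun n => [set y | Submod im0 imD imZ y /\ gm_piece N n y]) x.
Proof.
move=> [u _ <-]; have [p [pM _ _ /(_ u) [s us {1}->]]] := gm_proj M.
exists s, (fun i => f (p i u)); split=> //; last by rewrite raddf_sum.
by move=> i; split; [exists (p i u) | apply: gh_deg].
Qed.

Definition gim : hsubmod N := HSubmod gim_hom.
End Image.

Section Inclusion.
Variables (M : grmod R) (S : hsubmod M).

Definition ginc_fun : gsub S -> M := val.

Lemma ginc_linear : linear ginc_fun.
Proof. by []. Qed.

HB.instance Definition _ :=
  GRing.isLinear.Build R (gsub S) M *:%R ginc_fun ginc_linear.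

Lemma ginc_deg n x : gm_piece (gsub S) n x -> gm_piece M n (ginc_fun x).
Proof. by []. Qed.

Definition ginc : grhom (gsub S) M := GrHom ginc_deg.
End Inclusion.

Section Restriction.
Variables (M N : grmod R) (S : hsubmod M) (T : hsubmod N) (f : grhom M N).
Hypothesis fST : forall x, S x -> T (f x).

Definition gres_fun (x : gsub S) : gsub T := to_sub (fST (sub_typeP x)).

Lemma gres_linear : linear gres_fun.
Proof. by move=> a x y; apply: val_inj; rewrite /= linearP. Qed.

HB.instance Definition _ :=
  GRing.isLinear.Build R (gsub S) (gsub T) *:%R gres_fun gres_linear.

Lemma gres_deg n x : gm_piece (gsub S) n x -> gm_piece (gsub T) n (gres_fun x).
Proof. exact: (@gh_deg _ _ _ f n (val x)). Qed.

Definition gres : grhom (gsub S) (gsub T) := GrHom gres_deg.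
End Restriction.

End GradedTheory.

(* The clause on n says that I^n x is contained in J x. *)
Definition torsion (R : noethGradedRing) (I J : set R) (M : grmod R) : set M :=
  [set x | exists n0 : nat, forall n, (n0 <= n)%N ->
    forall a, ideal_exp I n a -> exists2 b, J b & a *: x = b *: x].
Arguments torsion {R} I J M.

Section HomogeneousIdeals.
Variable R : noethGradedRing.

Lemma gr_subgroup n : is_subgroup (gr_piece R n).
Proof. by have [] := gr_sum R. Qed.

Lemma hs_ideal (K : set R) : is_ideal K ->
  is_ideal (homsum (fun n => K `&` gr_piece R n)).
Proof.
move=> iK; have [K0 KD KM] := iK.
have gK n : is_subgroup (K `&` gr_piece R n).
  split; first by split=> //; apply: (gr_subgroup n).1.
  by move=> x y [Kx Rx] [Ky Ry]; split; [apply: (ideal_subgroup iK).2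
    | apply: (gr_subgroup n).2].
have gH := homsum_subgroup gK; split; first exact: gH.1.
  by move=> x y; apply: subgroupD.
move=> a x [s [f [us Kf ->]]]; rewrite mulr_sumr.
apply: subgroup_sum => // i _.
have [_ /(_ a) [t [g [_ Rg ->]]] _] := gr_sum R.
rewrite mulr_suml; apply: subgroup_sum => // j _.
have [Kfi Rfi] := Kf i; apply: (@homsum1 _ _ _ (j + i)%N) => //; split.
  exact: KM.
exact: gr_mul.
Qed.

Lemma ideal_gen_hom (S : set R) :
  S `<=` homsum (fun n => ideal_gen S `&` gr_piece R n) ->
  forall x, ideal_gen S x -> homsum (fun n => ideal_gen S `&` gr_piece R n) x.
Proof. by move=> SH x Sx; apply: (Sx _ (hs_ideal (ideal_gen_ideal S)) SH). Qed.

Lemma ideal_exp_hom (I : hideal R) n x : ideal_exp I n x ->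
  homsum (fun i => ideal_exp I n `&` gr_piece R i) x.
Proof.
elim: n x => [x _|n IH].
  have [_ /(_ x) [s [f [us Rf xE]]] _] := gr_sum R; by exists s, f; split.
move=> x Ix; refine (ideal_gen_hom _ Ix) => w [y [z []]].
move=> /hi_hom [s [f [us If ->]]] /IH [t [g [ut Jg ->]]] ->.
rewrite mulr_suml.
have iK := ideal_exp_ideal I n.+1.
have gH := ideal_subgroup (hs_ideal iK).
apply: subgroup_sum => // i _; rewrite mulr_sumr.
apply: subgroup_sum => // j _.
have [Ifi Rfi] := If i; have [Jgj Rgj] := Jg j.
apply: (@homsum1 _ _ _ (i + j)%N).
  move=> k; split; first by split; [case: iK | apply: (gr_subgroup k).1].
  by move=> u v [Ku Ru] [Kv Rv]; split; [apply: (ideal_subgroup iK).2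
    | apply: (gr_subgroup k).2].
by split; [apply: ideal_expS | apply: gr_mul].
Qed.

Lemma ideal_expM (I : set R) n m :
  ideal_exp I (n * m) `<=` ideal_exp (ideal_exp I n) m.
Proof.
elim: m => [|m IH]; first by move=> x _.
rewrite mulnS; apply: ideal_expD; first exact: ideal_exp_ideal.
by move=> u v Iu /IH Iv; apply: ideal_expS.
Qed.

Lemma prod_congr (J : set R) (I : Type) (r : seq I) (F G : I -> R) :
  is_ideal J -> (forall i, J (F i - G i)) ->
  J (\prod_(i <- r) F i - \prod_(i <- r) G i).
Proof.
move=> iJ JFG; have [J0 JD JM] := iJ; elim: r => [|i r IH].
  by rewrite !big_nil subrr.
rewrite !big_cons; set P := \prod_(_ <- _) _; set Q := \prod_(_ <- _) _.
have -> : F i * P - G i * Q = P * (F i - G i) + G i * (P - Q).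
  by rewrite !mulrBr [P * G i]mulrC [P * F i]mulrC addrA subrK.
by apply: JD; apply: JM.
Qed.

Lemma det_congr (J : set R) n (C D : 'M[R]_n) :
  is_ideal J -> (forall i j, J (C i j - D i j)) -> J (\det C - \det D).
Proof.
move=> iJ JCD; rewrite /determinant -sumrB.
apply: subgroup_sum => [|s _]; first exact: ideal_subgroup.
rewrite -mulrBr; case: (iJ) => _ _; apply; exact: prod_congr.
Qed.

Section Torsion.
Variables (I J : hideal R) (M : grmod R).

Let transp (x : M) : set R := [set a | exists2 b, J b & a *: x = b *: x].

Let transp_ideal x : is_ideal (transp x).
Proof.
have [J0 JD JM] := hi_ideal J; split.
- by exists 0.
- move=> a a' [b Jb ab] [b' Jb' ab']; exists (b + b'); first exact: JD.
  by rewrite !scalerDl ab ab'.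
- move=> c a [b Jb ab]; exists (c * b); first exact: JM.
  by rewrite -!scalerA ab.
Qed.

Let torsion_at n x : ideal_exp I n `<=` transp x -> torsion I J M x.
Proof.
by move=> Ix; exists n => m nm a Ia; apply: Ix; apply: ideal_exp_decr Ia.
Qed.

Lemma torsion_0 : torsion I J M 0.
Proof.
exists 0%N => n _ a _; exists 0; first by case: (hi_ideal J).
by rewrite !scaler0.
Qed.

Lemma torsion_D x y : torsion I J M x -> torsion I J M y ->
  torsion I J M (x + y).
Proof.
move=> [n Ix] [m Iy]; apply: (@torsion_at (n + m)%N).
apply: ideal_expD => // u v Iu Iv.
have [j Jj uj] := Ix n (leqnn _) u Iu; have [k Jk vk] := Iy m (leqnn _) v Iv.
have [_ JD JM] := hi_ideal J.
exists (u * k + v * j - j * k).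
  apply: (ideal_subgroup (hi_ideal J)).2; last exact: JM.
  by apply: JD; apply: JM.
have ux : (u - j) *: x = 0 by rewrite scalerBl uj subrr.
have vy : (v - k) *: y = 0 by rewrite scalerBl vk subrr.
apply/eqP; rewrite -subr_eq0 -scalerBl.
have -> : u * v - (u * k + v * j - j * k) = (v - k) * (u - j) by ring.
by rewrite scalerDr -scalerA ux scaler0 add0r mulrC -scalerA vy scaler0.
Qed.

Lemma torsion_Z (c : R) x : torsion I J M x -> torsion I J M (c *: x).
Proof.
move=> [n Ix]; exists n => m nm a Ia; have [b Jb ab] := Ix m nm a Ia.
by exists b; rewrite // !scalerA ![_ * c]mulrC -!scalerA ab.
Qed.

Definition torsion_submod := Submod torsion_0 torsion_D torsion_Z.

(* The components of x in a finite support are killed by a matrix a%:M - B with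
   B over J, hence by its determinant, which is a power of a modulo J. *)
Lemma torsion_power n x (a : R) e i
    (p : int -> {additive M -> M}) :
  [/\ forall n x, gm_piece M n (p n x),
      forall n x, gm_piece M n x -> p n x = x,
      forall n m x, gm_piece M n x -> m != n -> p m x = 0 &
      forall x, exists2 s, uniq s & x = \sum_(n <- s) p n x] ->
  ideal_exp I n `<=` transp x -> ideal_exp I n a -> gr_piece R e a ->
  radical (transp (p i x)) a.
Proof.
move=> pP Ix Ia Ra; have [pM pE p0 ps] := pP.
have [J0 JD JM] := hi_ideal J; have gJ := ideal_subgroup (hi_ideal J).
have pZ t (c : R) m y : gr_piece R t c -> p (t%:Z + m) (c *: y) = c *: p m y.
  move=> Rc.
  have -> : p (t%:Z + m) (c *: y) = p (t%:Z + m) (c *: p m y).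
    apply: (proj_only (h := p (t%:Z + m) \o ( *:%R c)) pP) => k z Mz km /=.
    apply: p0 (gm_act Rc Mz) _; apply: contraNneq km => /addrI ->.
    exact: eqxx.
  by apply: pE; apply: gm_act.
have [s us xE] := ps x.
have [si|si] := boolP (i \in s); last first.
  exists 1%N; exists 0; rewrite // scale0r xE raddf_sum big1_seq ?scaler0 //.
  move=> j /= sj; apply: p0 (pM j x) _.
  by apply: contraNneq si => ->.
pose r := size s; pose k (j : 'I_r) := nth 0 s j; pose z j := p (k j) x.
have kinj : injective k.
  move=> j l /eqP; rewrite nth_uniq ?ltn_ord // => /eqP; exact: val_inj.
have [b Jb ab] := Ix a Ia.
have [t [g [ut Jg bE]]] := hi_hom Jb.
have xE' : x = \sum_(l < r) z l.
  by rewrite {1}xE (big_nth 0) big_mkord.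
have pz m : p m x = \sum_(l < r) (if k l == m then z l else 0).
  rewrite {1}xE' raddf_sum; apply: eq_bigr => l _.
  case: eqP => [<-|/eqP km]; first exact: pE (pM _ _).
  by apply: p0 (pM (k l) x) _; rewrite eq_sym.
pose B : 'M[R]_r := \matrix_(j, l)
  \sum_(q <- t) (if k l == e%:Z + k j - q%:Z then g q else 0).
have JB j l : J (B j l).
  rewrite mxE; apply: subgroup_sum => // q _; case: ifP => // _.
  by have [] := Jg q.
have aB j : a *: z j = \sum_(l < r) B j l *: z l.
  rewrite /z -(pZ e) // ab bE scaler_suml raddf_sum.
  under [RHS]eq_bigr do rewrite mxE scaler_suml.
  rewrite exchange_big /=; apply: eq_bigr => q _.
  rewrite -{1}[e%:Z + k j](subrKC q%:Z) pZ; last by have [] := Jg q.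
  rewrite pz scaler_sumr; apply: eq_bigr => l _.
  by case: ifP => _; rewrite ?scaler0 ?scale0r.
pose C := a%:M - B.
have Cz j : \sum_(l < r) C j l *: z l = 0.
  under eq_bigr do rewrite !mxE scalerBl.
  rewrite sumrB (bigD1 j) //= eqxx mulr1n big1 ?addr0 => [|l /negPf lj].
    by rewrite aB -sumrB big1 // => l _; rewrite ?mxE subrr.
  by rewrite eq_sym lj mulr0n scale0r.
have detC l : \det C *: z l = 0.
  have -> : \det C *: z l = \sum_(m < r) (\adj C *m C) l m *: z m.
    rewrite mul_adj_mx (bigD1 l) //= mxE eqxx mulr1n big1 ?addr0 // => m ml.
    by rewrite mxE eq_sym (negPf ml) mulr0n scale0r.
  under eq_bigr do rewrite mxE scaler_suml.
  rewrite exchange_big big1 // => j _ /=.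
  under eq_bigr do rewrite -scalerA.
  by rewrite -scaler_sumr Cz scaler0.
have Jdet : J (a ^+ r - \det C).
  rewrite -(det_scalar r a); apply: det_congr; first exact: hi_ideal.
  by move=> j l; rewrite !mxE opprB addrC subrK; have := JB j l; rewrite mxE.
exists r; exists (a ^+ r - \det C) => //.
have [l ->] : exists l, p i x = z l.
  have ir : (index i s < r)%N by rewrite index_mem.
  by exists (Ordinal ir); rewrite /z /k /= nth_index.
by rewrite scalerBl detC subr0.
Qed.

Lemma torsion_hom x : torsion_submod x ->
  homsum (fun n => [set y | torsion_submod y /\ gm_piece M n y]) x.
Proof.
move=> [n Ix]; have {}Ix : ideal_exp I n `<=` transp x by apply: Ix.
have [p pP] := gm_proj M; have [pM pE p0 /(_ x) [s us xE]] := pP.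
exists s, (fun i => p i x); split=> // i; split=> //.
have iT := transp_ideal (p i x).
have rad : ideal_exp I n `<=` radical (transp (p i x)).
  move=> a /ideal_exp_hom [t [g [ut Ig ->]]].
  apply: subgroup_sum => [|e _]; first exact/ideal_subgroup/radical_ideal.
  by have [Ige Rge] := Ig e; apply: torsion_power pP Ix Ige Rge.
have [t tE] := gr_noeth (ideal_exp_ideal I n).
have [a at_|N HN] := @fg_radical_exp _ t _ iT.
  by apply: rad; rewrite tE; apply: sub_ideal_gen.
apply: (@torsion_at (n * N)%N) => a /ideal_expM.
by rewrite tE; apply: HN.
Qed.

Definition gtorsion_sub : hsubmod M := HSubmod torsion_hom.

Definition gtorsion : grmod R := gsub gtorsion_sub.
End Torsion.

Section TorsionMap.
Variables (I J : hideal R) (M N : grmod R) (f : grhom M N).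

Lemma torsion_map x : gtorsion_sub I J M x -> gtorsion_sub I J N (f x).
Proof.
move=> [n Ix]; exists n => m nm a Ia; have [b Jb ab] := Ix m nm a Ia.
by exists b; rewrite // -!linearZ ab.
Qed.

Definition gtorsion_map : grhom (gtorsion I J M) (gtorsion I J N) :=
  gres torsion_map.
End TorsionMap.
End HomogeneousIdeals.

(* ker g / (ker g `&` S), for S a submodule of B; in use S is the image of the
   previous differential, contained in ker g. *)
Definition gcohom (R : noethGradedRing) (B C : grmod R) (g : grhom B C)
    (S : hsubmod B) : grmod R :=
  gquot (gpre (ginc (gker g)) S).

(* Injective object of the category of graded modules and degree 0 maps, in
   which monomorphisms are the injective maps. *)
Definition gr_injective (R : noethGradedRing) (E : grmod R) : Prop :=
  forall (A B : grmod R) (i : grhom A B) (f : grhom A E), injective i ->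
    exists g : grhom B E, forall x, g (i x) = f x.

Section RatModInt.

Definition int_rat_pred : {pred rat} := fun x => x \in Num.int.
Lemma int_rat_pred_closed : zmod_closed int_rat_pred.
Proof. by split=> [|x y]; [exact: rpred0 | exact: rpredB]. Qed.
HB.instance Definition _ :=
  GRing.isZmodClosed.Build rat int_rat_pred int_rat_pred_closed.

Definition QmodZ : zmodType := Quotient.quot int_rat_pred.
Definition qz (x : rat) : QmodZ := (\pi_(Quotient.quot int_rat_pred) x)%qT.

Lemma qzB : zmod_morphism qz.
Proof. exact: (raddfB (\pi_(Quotient.quot int_rat_pred))%qT). Qed.
HB.instance Definition _ := GRing.isZmodMorphism.Build rat QmodZ qz qzB.

Lemma qz_eq0 x : (qz x == 0) = (x \in Num.int).
Proof.
by rewrite -(raddf0 qz) -Quotient.idealrBE subr0.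
Qed.

Lemma QmodZ_div n (y : QmodZ) : (0 < n)%N -> exists z, z *+ n = y.
Proof.
move=> n0; have -> : y = qz (generic_quotient.repr y).
  by rewrite /qz generic_quotient.reprK.
exists (qz (generic_quotient.repr y / n%:R)).
by rewrite -[LHS]raddfMn -[X in qz X = _]mulr_natr divfK // pnatr_eq0 -lt0n.
Qed.

Lemma QmodZ_tors n : (1 < n)%N -> exists y : QmodZ, y != 0 /\ y *+ n = 0.
Proof.
move=> n1; have n0 : (n%:R : rat) != 0 by rewrite pnatr_eq0 -lt0n ltnW.
exists (qz n%:R^-1); split; last first.
  rewrite -[LHS]raddfMn -[X in qz X = _]mulr_natr mulVf //; apply/eqP; rewrite qz_eq0.
  exact: rpred1.
rewrite qz_eq0; apply/negP => /intrP [m /eqP].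
rewrite -(inj_eq (mulIf n0)) mulVf // -[n%:R]/(n%:Z%:~R) -intrM.
rewrite -[1]/(1%:~R) eqr_int => /eqP /esym m1.
have /dvdzP : (n%:Z %| 1)%Z by apply/dvdzP; exists m.
by move=> /dvdzP; rewrite dvdzE /= dvdn1 => /eqP n1'; rewrite n1' in n1.
Qed.

End RatModInt.


Section Divisible.
Variable V : zmodType.
Implicit Type G : set (V * QmodZ).

Let good G := is_subgroup G /\ forall y, G (0, y) -> y = 0.

Let step G x y : set (V * QmodZ) :=
  [set p | exists q (k : int), G q /\ p = (q.1 + x *~ k, q.2 + y *~ k)].

Let pairB (x x' : V) (y y' : QmodZ) : (x, y) - (x', y') = (x - x', y - y').
Proof. by []. Qed.

Let good_fun G x y y' : good G -> G (x, y) -> G (x, y') -> y = y'.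
Proof.
move=> [[_ GB] G0] Gy Gy'; apply/eqP; rewrite -subr_eq0; apply/eqP/G0.
by have := GB _ _ Gy Gy'; rewrite pairB subrr.
Qed.

Let step_good G x y : good G ->
  (forall k w, G (x *~ k, w) -> w = y *~ k) ->
  [/\ good (step G x y), G `<=` step G x y & step G x y (x, y)].
Proof.
move=> [gG G0] Gxy; have [G00 GB] := gG; split; first split.
- split; first by exists 0, 0; split=> //; rewrite !mulr0z !addr0.
  move=> _ _ [q [k [Gq ->]]] [q' [k' [Gq' ->]]].
  exists (q - q'), (k - k'); split; first exact: GB.
  by rewrite pairB !mulrzBr !opprD; congr pair; exact: addrACA.
- move=> w [[u v] [k [Gq /= [/esym/eqP]]]]; rewrite addr_eq0 => /eqP uE ->.
  rewrite uE -mulrNz in Gq; rewrite (Gxy _ _ Gq) mulrNz addrC.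
  exact: subrr.
- by move=> [u v] Gq; exists (u, v), 0; rewrite !mulr0z !addr0.
- by exists 0, 1; split => //; rewrite !mulr1z !add0r.
Qed.

Let step_ex G x : good G -> exists y, forall k w, G (x *~ k, w) -> w = y *~ k.
Proof.
move=> gdG; have [gG G0] := gdG.
have GN u v : G (u, v) -> G (- u, - v) by move=> /(subgroupN gG).
have GM u v (m : int) : G (u, v) -> G (u *~ m, v *~ m).
  move=> Guv; have GMn n : G (u *+ n, v *+ n).
    elim: n => [|n IH]; first by rewrite !mulr0n; exact: gG.1.
    by rewrite !mulrS; exact: (subgroupD gG Guv IH).
  case: m => n; first by rewrite -!pmulrn.
  by rewrite NegzE !mulrNz; apply: GN; rewrite -!pmulrn.
have [[n]|none] := pselect (exists n, (0 < n)%N && `[< exists w, G (x *+ n, w) >]);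
    last first.
  exists 0 => k w Gk; rewrite mul0rz.
  have [k0|] := eqVneq k 0; first by apply: G0; move: Gk; rewrite k0 mulr0z.
  rewrite -absz_gt0 => k0; case: none; exists `|k|%N; rewrite k0; apply/asboolP.
  case: k {k0} Gk => n Gk; first by exists w.
  by exists (- w); have := GN _ _ Gk; rewrite NegzE mulrNz opprK.
move=> Pn; have exn : exists n, (0 < n)%N && `[< exists w, G (x *+ n, w) >].
  by exists n.
case: (ex_minnP exn) => {Pn exn} {}n /andP [n0 /asboolP [v Gv]] nmin.
have [y yn] := QmodZ_div v n0; exists y => k w Gk.
have [q [r [kE rn]]] : exists (q : int) (r : nat), k = q * n%:Z + r%:Z /\ (r < n)%N.
  have n0' : n%:Z != 0 by case: (n) n0.
  have := modz_ge0 k n0'; have := ltz_pmod k (d := n%:Z) n0.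
  have := divz_eq k n%:Z; case: (k %% n)%Z => // r kE rn _.
  by exists (k %/ n)%Z, r.
have Gqn : G (x *~ (q * n%:Z), v *~ q).
  by have := GM _ _ q Gv; rewrite pmulrn -mulrzA mulrC.
have Gr : G (x *+ r, w - v *~ q).
  have := gG.2 _ _ Gk Gqn; rewrite pairB -mulrzBr kE addrC addKr.
  by rewrite -pmulrn.
have r0 : r = 0%N.
  apply/eqP; rewrite -leqn0 leqNgt; apply/negP => r0.
  have : (n <= r)%N by apply: nmin; rewrite r0; apply/asboolP; exists (w - v *~ q).
  by rewrite leqNgt rn.
rewrite r0 addr0 in kE; rewrite kE in Gk.
by rewrite (good_fun gdG Gk Gqn) kE -yn pmulrn -mulrzA mulrC.
Qed.

Let extend_good G : good G ->
  exists f : {additive V -> QmodZ}, forall x y, G (x, y) -> f x = y.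
Proof.
move=> gdG.
pose P (H : set (V * QmodZ)) := H = set0 \/ (good H /\ G `<=` H).
have [F FP totF|H [PH Hmax]] := @Zorn_bigcup _ P.
  have goodF H p : F H -> H p -> good H /\ G `<=` H.
    by move=> FH Hp; case: (FP _ FH) => // H0; move: Hp; rewrite H0.
  have [[H [p [FH Hp]]]|F0] := pselect (exists H p, F H /\ H p); last first.
    by left; rewrite -subset0 => p [H FH Hp]; apply: F0; exists H, p.
  have [gdH GH] := goodF _ _ FH Hp; right; split; last first.
    by move=> q Gq; exists H => //; apply: GH.
  split; first split.
  - by exists H => //; case: gdH => [[]].
  - move=> q q' [K FK Kq] [K' FK' Kq'].
    have [KK|KK] := totF _ _ FK FK'.
      have [[[_ gB] _] _] := goodF _ _ FK' Kq'.
      by exists K' => //; apply: gB => //; apply: KK.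
    have [[[_ gB] _] _] := goodF _ _ FK Kq.
    by exists K => //; apply: gB => //; apply: KK.
  - by move=> y [K FK Ky]; have [[_ K0] _] := goodF _ _ FK Ky; apply: K0.
have [gdH GH] : good H /\ G `<=` H.
  case: PH => // H0; exfalso; apply: (Hmax G); last by right; split=> // p.
  rewrite H0; split; first exact: sub0set.
  by move=> /(_ (0, 0)); apply; case: gdG => [[]].
have total x : exists y, H (x, y).
  have [y yP] := step_ex x gdH; have [gdS HS Sxy] := step_good gdH yP.
  have [Hxy|nHxy] := pselect (H (x, y)); first by exists y.
  exfalso; apply: (Hmax (step H x y)).
    by split=> [|SH]; [exact: HS | apply: nHxy; apply: SH].
  by right; split=> // p /GH; apply: HS.
pose f x := projT1 (cid (total x)).
have fP x : H (x, f x) by rewrite /f; case: cid.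
have fB : zmod_morphism f.
  move=> x y; apply: (good_fun gdH (fP _)).
  by rewrite -pairB; case: gdH => [[_ gB] _]; apply: gB.
pose g : {additive V -> QmodZ} :=
  HB.pack f (GRing.isZmodMorphism.Build V QmodZ f fB).
by exists g => x y /GH Hxy; exact: good_fun gdH (fP x) Hxy.
Qed.

Lemma QmodZ_injective (A : zmodType) (i : {additive A -> V})
    (f : {additive A -> QmodZ}) : injective i ->
  exists g : {additive V -> QmodZ}, forall a, g (i a) = f a.
Proof.
move=> inj_i; have [|g gE] := @extend_good [set p | exists a, p = (i a, f a)].
  split; first split.
  - by exists 0; rewrite !raddf0.
  - by move=> _ _ [a ->] [b ->]; exists (a - b); rewrite pairB !raddfB.
  - move=> y [a [/esym a0 ->]].
    by rewrite (inj_i a 0) ?raddf0.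
by exists g => a; apply: gE; exists a.
Qed.

Lemma QmodZ_separates (x : V) :
  (forall f : {additive V -> QmodZ}, f x = 0) -> x = 0.
Proof.
move=> fx0; apply: contrapT => /eqP x0.
have gd0 : good [set 0].
  split; first split => //.
  - by move=> _ _ -> ->; rewrite subr0.
  - by move=> y [].
have [y [y0 yP]] : exists y : QmodZ, y != 0 /\
    forall (k : int) w, [set (0 : V * QmodZ)] (x *~ k, w) -> w = y *~ k.
  have [[n]|none] := pselect (exists n, (0 < n)%N && (x *+ n == 0)); last first.
    have [y [y0 _]] := @QmodZ_tors 2 isT; exists y; split=> // k w [xk ->].
    have [->|] := eqVneq k 0; first by rewrite mulr0z.
    rewrite -absz_gt0 => k0; case: none; exists `|k|%N; rewrite k0 /=.
    case: k {k0} xk => n; first by move=> /eqP.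
    by rewrite NegzE mulrNz => /eqP; rewrite oppr_eq0.
  move=> Pn; have exn : exists n, (0 < n)%N && (x *+ n == 0) by exists n.
  case: (ex_minnP exn) => {Pn exn} {}n /andP [n0 /eqP xn] nmin.
  have n1 : (1 < n)%N.
    by rewrite ltn_neqAle n0 andbT; apply: contraNneq x0 => n1; rewrite -xn -n1.
  have [y [y0 yn]] := QmodZ_tors n1; exists y; split=> // k w [xk ->].
  have [q [r [kE rn]]] :
      exists (q : int) (r : nat), k = q * n%:Z + r%:Z /\ (r < n)%N.
    have n0' : n%:Z != 0 by case: (n) n0.
    have := modz_ge0 k n0'; have := ltz_pmod k (d := n%:Z) n0.
    have := divz_eq k n%:Z; case: (k %% n)%Z => // r kE rn _.
    by exists (k %/ n)%Z, r.
  have r0 : r = 0%N.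
    apply/eqP; rewrite -leqn0 leqNgt; apply/negP => r0.
    have : (n <= r)%N.
      apply: nmin; rewrite r0 -[X in X == _]add0r pmulrn; apply/eqP.
      rewrite -[RHS]xk kE mulrzDr; congr (_ + _).
      by rewrite mulrC mulrzA -pmulrn xn mul0rz.
    by rewrite leqNgt rn.
  by rewrite kE r0 addr0 mulrC mulrzA -pmulrn yn mul0rz.
have [gdS _ Sxy] := step_good gd0 yP; have [f fE] := extend_good gdS.
by move/eqP: y0; apply; rewrite -(fE _ _ Sxy).
Qed.
End Divisible.

Section AdditiveFunctions.
Variables (R : comNzRingType) (D : zmodType).

Definition addfun_pred : {pred R -> D} := fun f => `[< zmod_morphism f >].

Lemma addfun_pred_closed : zmod_closed addfun_pred.
Proof.
split; first by apply/asboolP => x y; rewrite subr0.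
move=> f g /asboolP fB /asboolP gB; apply/asboolP => x y.
rewrite -[LHS]/(f (x - y) - g (x - y)) fB gB opprD !opprK.
by rewrite -[in RHS]/(f x - g x - (f y - g y)) opprD opprK addrACA.
Qed.
HB.instance Definition _ :=
  GRing.isZmodClosed.Build (R -> D) addfun_pred addfun_pred_closed.

Definition addfun : Type := {f : R -> D | addfun_pred f}.
HB.instance Definition _ := SubChoice.on addfun.
HB.instance Definition _ := [SubChoice_isSubZmodule of addfun by <:].

Lemma addfunB (f : addfun) : zmod_morphism (val f).
Proof. by apply/asboolP; exact: (valP f). Qed.

Lemma addfunD (f : addfun) x y : val f (x + y) = val f x + val f y.
Proof.
pose h : {additive R -> D} :=
  HB.pack (val f) (GRing.isZmodMorphism.Build R D _ (addfunB f)).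
exact: (raddfD h).
Qed.

Definition mk_addfun (f : R -> D) (fB : zmod_morphism f) : addfun :=
  exist _ f (asboolT fB).

Lemma addfun_scale_subproof (a : R) (f : addfun) :
  zmod_morphism (fun r => val f (r * a)).
Proof. by move=> x y; rewrite mulrBl addfunB. Qed.

Definition addfun_scale a f := mk_addfun (addfun_scale_subproof a f).

Lemma addfun_ext (f g : addfun) : (forall r, val f r = val g r) -> f = g.
Proof. by move=> fg; apply: val_inj; apply: funext. Qed.

Lemma addfun_scaleA a b f :
  addfun_scale a (addfun_scale b f) = addfun_scale (a * b) f.
Proof. by apply: addfun_ext => r /=; rewrite mulrA. Qed.
Lemma addfun_scale1 : left_id 1 addfun_scale.
Proof. by move=> f; apply: addfun_ext => r /=; rewrite mulr1. Qed.
Lemma addfun_scaleDr : right_distributive addfun_scale +%R.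
Proof. by move=> a f g; apply: addfun_ext => r. Qed.
Lemma addfun_scaleDl f : {morph addfun_scale^~ f : a b / a + b}.
Proof.
move=> a b; apply: addfun_ext => r.
rewrite -[RHS]/(val f (r * a) + val f (r * b)) /=.
by rewrite mulrDr addfunD.
Qed.

HB.instance Definition _ := GRing.Zmodule_isLmodule.Build R addfun
  addfun_scaleA addfun_scale1 addfun_scaleDr addfun_scaleDl.

Lemma addfun_scaleE (a : R) (f : addfun) r : val (a *: f) r = val f (r * a).
Proof. by []. Qed.
Lemma addfun_addE (f g : addfun) r : val (f + g) r = val f r + val g r.
Proof. by []. Qed.
Lemma addfun_subE (f g : addfun) r : val (f - g) r = val f r - val g r.
Proof. by []. Qed.
Lemma addfun_sumE I (s : seq I) (f : I -> addfun) r :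
  val (\sum_(i <- s) f i) r = \sum_(i <- s) val (f i) r.
Proof.
elim: s => [|i s IH]; first by rewrite !big_nil.
by rewrite !big_cons addfun_addE IH.
Qed.
End AdditiveFunctions.

(* The graded module of additive maps from R to the graded group that is
   X -> Q/Z in each degree; it is injective since Q/Z is divisible. *)
Section Coinduced.
Variables (R : noethGradedRing) (X : Type).
Let D : zmodType := X -> QmodZ.
Let L : lmodType R := addfun R (int -> D).

Let A (n : int) : set L := [set f | forall k r m, gr_piece R k r ->
  m != k%:Z + n -> val f r m = 0].

Let gA n : is_subgroup (A n).
Proof.
split; first by move=> k r m _ _.
move=> f g Af Ag k r m Rr ne; rewrite addfun_subE.
rewrite -[LHS]/(val f r m - val g r m) (Af k) // (Ag k) //; exact: subrr.
Qed.

Let actA i n (a : R) f : gr_piece R i a -> A n f -> A (i%:Z + n) (a *: f).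
Proof.
move=> Ra Af k r m Rr ne; rewrite addfun_scaleE (Af (k + i)%N) //.
  exact: gr_mul.
by rewrite PoszD -addrA.
Qed.

Let sumE I (s : seq I) (f : I -> int -> D) m :
  (\sum_(i <- s) f i) m = \sum_(i <- s) f i m.
Proof.
elim: s => [|i s IH]; first by rewrite !big_nil.
by rewrite !big_cons -IH.
Qed.

Let inA : independent A.
Proof.
move=> s f us Af f0 i si.
have fr0 k r m : gr_piece R k r -> val (f i) r m = 0.
  move=> Rr; have [->|] := eqVneq m (k%:Z + i); last exact: Af.
  have : val (\sum_(j <- s) f j) r (k%:Z + i) = 0 by rewrite f0.
  rewrite addfun_sumE sumE (bigD1_seq i) //= big1 ?addr0 // => j ji.
  apply: (Af j k) => //; apply: contraNneq ji => /addrI ->; exact: eqxx.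
apply: addfun_ext => r; apply: funext => m.
have [_ /(_ r) [t [g [ut Rg ->]]] _] := gr_sum R.
pose h : {additive R -> (int -> D)} :=
  HB.pack (val (f i)) (GRing.isZmodMorphism.Build R (int -> D) _ (addfunB (f i))).
rewrite -[val (f i)]/(h : R -> _) raddf_sum sumE big1 // => j _.
exact: fr0 (Rg j).
Qed.

Let S : set L := homsum A.
Let gS : is_subgroup S. Proof. exact: homsum_subgroup. Qed.
Let S0 : S 0. Proof. by case: gS. Qed.
Let SD x y : S x -> S y -> S (x + y). Proof. exact: subgroupD. Qed.
Let SZ (a : R) f : S f -> S (a *: f).
Proof.
move=> [s [g [us Ag ->]]]; rewrite scaler_sumr.
apply: subgroup_sum => // i _.
have [_ /(_ a) [t [b [ut Rb ->]]] _] := gr_sum R.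
rewrite scaler_suml; apply: subgroup_sum => // j _.
by apply: (@homsum1 _ _ _ (j%:Z + i)) => //; apply: actA.
Qed.

Let spA x : Submod S0 SD SZ x ->
  homsum (fun n => [set y | Submod S0 SD SZ y /\ A n y]) x.
Proof.
move=> [s [g [us Ag ->]]]; exists s, g; split=> // i; split=> //.
exact: homsum1 (Ag i).
Qed.

Definition coind : grmod R := span_grmod gA actA inA spA.

Section Map.
Variables (B : grmod R) (g : int -> B -> D).
Hypothesis gB : forall m, zmod_morphism (g m).
Hypothesis g0 : forall n m b, gm_piece B n b -> m != n -> g m b = 0.

Let h_fun b : R -> int -> D := fun r m => g m (r *: b).
Let h_funB b : zmod_morphism (h_fun b).
Proof. by move=> x y; apply: funext => m; rewrite /h_fun scalerBl gB. Qed.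
Let h b : L := mk_addfun (h_funB b).

Let hA n b : gm_piece B n b -> A n (h b).
Proof. by move=> Bb k r m Rr ne; apply: g0 ne; apply: gm_act. Qed.

Let hB x y : h (x - y) = h x - h y.
Proof.
apply: addfun_ext => r; apply: funext => m.
by rewrite -[LHS]/(g m (r *: (x - y))) scalerBr gB.
Qed.

Let hS b : S (h b).
Proof.
have [_ /(_ b) [t [c [ut Bc ->]]] _] := gm_sum B.
pose h' : {additive B -> L} := HB.pack h (GRing.isZmodMorphism.Build B L _ hB).
rewrite -[h]/(h' : B -> L) raddf_sum.
apply: subgroup_sum => // i _; apply: (@homsum1 _ _ _ i) => //; exact: hA.
Qed.

Definition coind_map_fun b : coind :=
  @to_sub R L (Submod S0 SD SZ) (h b) (hS b).

Lemma coind_map_linear : linear coind_map_fun.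
Proof.
move=> a x y; apply: val_inj; apply: addfun_ext => r; apply: funext => m.
rewrite -[LHS]/(g m (r *: (a *: x + y))).
rewrite -[RHS]/(g m ((r * a) *: x) + g m (r *: y)).
pose gm : {additive B -> D} :=
  HB.pack (g m) (GRing.isZmodMorphism.Build B D _ (gB m)).
by rewrite scalerDr scalerA; exact: (raddfD gm).
Qed.
HB.instance Definition _ :=
  GRing.isLinear.Build R B coind *:%R coind_map_fun coind_map_linear.

Lemma coind_map_deg n b : gm_piece B n b -> gm_piece coind n (coind_map_fun b).
Proof. exact: hA. Qed.

Definition coind_map : grhom B coind := GrHom coind_map_deg.

Lemma coind_mapE b r m : val (val (coind_map b)) r m = g m (r *: b).
Proof. by []. Qed.
End Map.

Lemma coind_injective : gr_injective coind.
Proof.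
move=> M N i f inj_i.
have [p [pM pE p0 ps]] := gm_proj M; have [q [qN qE q0 qs]] := gm_proj N.
pose phi m (x : X) (a : M) : QmodZ := val (val (f a)) 1 m x.
have phiB m x : zmod_morphism (phi m x).
  by move=> a b; rewrite /phi raddfB.
pose phi' m x : {additive M -> QmodZ} :=
  HB.pack (phi m x) (GRing.isZmodMorphism.Build M QmodZ _ (phiB m x)).
have ext m x : exists psi : {additive N -> QmodZ}, forall a, psi (i a) = phi m x a.
  exact: (QmodZ_injective (i := i) (phi' m x) inj_i).
pose psi m x := projT1 (cid (ext m x)).
have psiE m x a : psi m x (i a) = phi m x a by rewrite /psi; case: cid.
pose g m (b : N) : D := fun x => psi m x (q m b).
have gB m : zmod_morphism (g m).
  by move=> a b; apply: funext => x; rewrite /g !raddfB.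
have g0 n m b : gm_piece N n b -> m != n -> g m b = 0.
  by move=> Nb mn; apply: funext => x; rewrite /g (q0 n) // raddf0.
exists (coind_map gB g0) => a; apply: val_inj; apply: addfun_ext => r.
apply: funext => m; apply: funext => x; rewrite coind_mapE /g.
rewrite -linearZ -(grhom_proj i m (And4 pM pE p0 ps) qE q0) psiE.
have -> : val (val (f a)) r m x = phi m x (r *: a).
  by rewrite /phi linearZ -[RHS]/(val (val (f a)) (1 * r) m x) mul1r.
rewrite -[phi m x]/(phi' m x : M -> _).
apply/esym/(proj_only (h := phi' m x) (And4 pM pE p0 ps)) => n y My nm.
rewrite /= /phi; have /(_ 0%N 1 m (gr_one R)) := gh_deg f My.
by rewrite add0r eq_sym => -> //.
Qed.

End Coinduced.

Lemma enough_gr_injectives (R : noethGradedRing) (M : grmod R) :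
  exists E : grmod R, gr_injective E /\ exists i : grhom M E, injective i.
Proof.
have [p [pM pE p0 ps]] := gm_proj M.
pose X := {additive M -> QmodZ}.
pose g m (b : M) : X -> QmodZ := fun x => x (p m b).
have gB m : zmod_morphism (g m).
  by move=> a b; apply: funext => x; rewrite /g !raddfB.
have g0 n m b : gm_piece M n b -> m != n -> g m b = 0.
  by move=> Nb mn; apply: funext => x; rewrite /g (p0 n) // raddf0.
exists (coind R X); split; first exact: coind_injective.
exists (coind_map gB g0); apply: raddf_inj => a a0.
have pa m : p m a = 0.
  apply: QmodZ_separates => x; have := coind_mapE gB g0 a 1 m.
  by rewrite a0 scale1r => /(congr1 (@^~ x)).
by have [s _ ->] := ps a; rewrite big1.
Qed.

Record gr_injective_resolution (R : noethGradedRing) (M : grmod R) := GrInjRes {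
  res_obj :> nat -> grmod R;
  res_aug : grhom M (res_obj 0);
  res_dif : forall i, grhom (res_obj i) (res_obj i.+1);
  res_injective : forall i, gr_injective (res_obj i);
  res_aug_inj : injective res_aug;
  res_exact0 : forall x, res_dif 0 x = 0 <-> exists y, res_aug y = x;
  res_exactS : forall i x, res_dif i.+1 x = 0 <-> exists y, res_dif i y = x
}.

Section ResolutionExistence.
Variables (R : noethGradedRing) (M : grmod R).

Let hull (N : grmod R) : grmod R := projT1 (cid (enough_gr_injectives N)).
Let hullP N : gr_injective (hull N) /\ exists i : grhom N (hull N), injective i.
Proof. by rewrite /hull; case: cid. Qed.
Let emb N : grhom N (hull N) := projT1 (cid (hullP N).2).
Let emb_inj N : injective (emb N).
Proof. by rewrite /emb; case: cid. Qed.

Let coker_pi (N : grmod R) (S : hsubmod N) : grhom N (gquot S).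
Proof.
refine (@GrHom R N (gquot S) (quot_pi S) _) => n x Nx.
by exists x.
Defined.

Fixpoint syzygy (i : nat) : grmod R :=
  if i is i'.+1 then gquot (gim (emb (syzygy i'))) else M.

Let dif i : grhom (hull (syzygy i)) (hull (syzygy i.+1)).
Proof.
refine (@GrHom R _ _ (emb (syzygy i.+1) \o coker_pi (gim (emb (syzygy i)))) _).
by move=> n x Ex; do 2 apply: gh_deg.
Defined.

Let dif_ker i x : dif i x = 0 <-> exists y, emb (syzygy i) y = x.
Proof.
have pi0 : dif i x = 0 <-> coker_pi (gim (emb (syzygy i))) x = 0.
  split=> [|d0]; last by rewrite /dif /= d0 raddf0.
  by rewrite -[0 in X in X -> _](raddf0 (emb (syzygy i.+1))) => /emb_inj.
rewrite pi0 -[0](raddf0 (coker_pi (gim (emb (syzygy i))))) quot_piE subr0.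
by split=> [[y _ yx]|[y yx]]; exists y.
Qed.

Lemma gr_injective_resolution_exists : inhabited (gr_injective_resolution M).
Proof.
constructor; apply: (@GrInjRes R M (fun i => hull (syzygy i)) (emb M) dif).
- by move=> i; case: (hullP (syzygy i)).
- exact: emb_inj.
- exact: (@dif_ker 0%N).
- move=> i x; rewrite dif_ker; split=> [[y <-]|[z <-]].
    by have [z <-] := quot_pi_surj y; exists z.
  by exists (coker_pi (gim (emb (syzygy i))) z).
Qed.
End ResolutionExistence.

(* A resolution fixed once and for all by choice, as in the usual definition of
   right derived functors; another one gives isomorphic cohomology. *)
Definition gr_resolution (R : noethGradedRing) (M : grmod R) :
    gr_injective_resolution M :=
  inhabited_witness (gr_injective_resolution_exists M).

Definition local_cohom (R : noethGradedRing) (I J : hideal R) (i : nat)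
    (M : grmod R) : grmod R :=
  let E := gr_resolution M in
  let d j := gtorsion_map I J (res_dif E j) in
  if i is j.+1 then gcohom (d j.+1) (gim (d j)) else gcohom (d 0%N) (gzero _).

(* c is the supremum of the (nonempty, bounded) set of i with H^i_{I,J}(M) <> 0;
   a supremum of naturals which is finite is attained. *)
Definition is_cd (R : noethGradedRing) (I J : hideal R) (M : grmod R)
    (c : nat) : Prop :=
  (exists x : local_cohom I J c M, x <> 0) /\
  forall i, (exists x : local_cohom I J i M, x <> 0) -> (i <= c)%N.

Section StandardIdeals.
Variable R : noethGradedRing.

Let Rpos (n : nat) : set R := [set x | gr_piece R n x /\ (n = 0%N -> x = 0)].

Let gRpos n : is_subgroup (Rpos n).
Proof.
split; first by split=> //; apply: (gr_subgroup R n).1.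
move=> x y [Rx x0] [Ry y0]; split; first exact: (gr_subgroup R n).2.
by move=> n0; rewrite x0 // y0 // subrr.
Qed.

Lemma irrelevant_is_ideal : is_ideal (homsum Rpos).
Proof.
have gH := homsum_subgroup gRpos; split; first exact: gH.1.
  by move=> x y; apply: subgroupD.
move=> a x [s [f [us Rf ->]]]; rewrite mulr_sumr.
apply: subgroup_sum => // i _.
have [_ /(_ a) [t [g [_ Rg ->]]] _] := gr_sum R.
rewrite mulr_suml; apply: subgroup_sum => // j _.
have [Rfi f0] := Rf i; apply: (@homsum1 _ _ _ (j + i)%N) => //; split.
  exact: gr_mul.
by move=> /eqP; rewrite addn_eq0 => /andP [_ /eqP /f0 ->]; rewrite mulr0.
Qed.

Lemma irrelevant_hom x : homsum Rpos x ->
  homsum (fun n => [set y | homsum Rpos y /\ gr_piece R n y]) x.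
Proof.
move=> [s [f [us Rf ->]]]; exists s, f; split=> // i; split.
  exact: homsum1 (Rf i).
by case: (Rf i).
Qed.

(* R_+, the sum of the R_n for n > 0. *)
Definition irrelevant : hideal R := HIdeal irrelevant_is_ideal irrelevant_hom.

Variable m0 : set (base_ring R).

Let m0R : set R := ideal_gen [set val y | y in m0].

Lemma ext_ideal_hom x : m0R x ->
  homsum (fun n => [set y | m0R y /\ gr_piece R n y]) x.
Proof.
apply: ideal_gen_hom => _ [y my <-]; apply: (@homsum1 _ _ _ 0%N).
  move=> n; have iG := ideal_gen_ideal [set val y | y in m0].
  split; first by split; [case: iG | apply: (gr_subgroup R n).1].
  by move=> u v [Ku Ru] [Kv Rv]; split; [apply: (ideal_subgroup iG).2
    | apply: (gr_subgroup R n).2].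
split; first by apply: sub_ideal_gen; exists y.
by apply/asboolP; exact: (valP y).
Qed.

(* m0 R. *)
Definition ext_ideal : hideal R :=
  HIdeal (ideal_gen_ideal [set val y | y in m0]) ext_ideal_hom.
End StandardIdeals.

Definition fin_gen (R : noethGradedRing) (M : grmod R) : Prop :=
  exists s : seq M, forall x : M, exists a : nat -> R,
    x = \sum_(i < size s) a i *: s`_i.

(* M_n is finitely generated as an R_0-module. *)
Definition fin_gen_piece (R : noethGradedRing) (M : grmod R) (n : int) : Prop :=
  exists s : seq M, (forall y, y \in s -> gm_piece M n y) /\
    forall x, gm_piece M n x -> exists a : nat -> base_ring R,
      x = \sum_(i < size s) val (a i) *: s`_i.

Definition tame (R : noethGradedRing) (T : grmod R) : Prop :=
  (exists n0 : int, forall n, n <= n0 -> gm_piece T n = [set 0]) \/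
  (exists n0 : int, forall n, n <= n0 -> gm_piece T n <> [set 0]).

(* Main.v *)
(* On homogeneous elements (R_+, m0 R)-torsion is R_+-torsion: if x is homogeneous
   and R_+^k x is contained in m0 R x, then R_k x = m0 R_k x, and R_k x = 0 by
   Nakayama's lemma. So H^i is ordinary graded local cohomology at R_+.

   For c > 0, the Koszul complex of M on generators x_1, ..., x_r of R_1 consists
   of sums of shifts of M and has R_+-torsion homology, which has no higher
   local cohomology. Since H^i(M) = 0 for i > c, descending along this finite
   complex shows that H^(c+1) of its cycles and boundaries vanishes, and hence
   that (x_1, ..., x_r) : H^c(M)(-1)^r -> H^c(M) is onto. Therefore
   H^c(M)_(n-1) = 0 implies H^c(M)_n = 0. For c = 0, H^0(M) embeds in M. *)
From HB Require Import structures.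
Require Import Defs.
From mathcomp Require Import all_boot all_order all_algebra.
From mathcomp Require Import boolp classical_sets functions.

Set Implicit Arguments.
Unset Strict Implicit.
Unset Printing Implicit Defensive.

Import Order.TTheory GRing.Theory Num.Theory.

Local Open Scope classical_set_scope.
Local Open Scope ring_scope.

(** * Graded modules *)

(** The local cohomology modules come from one chosen resolution, and building connecting maps and
    long exact sequences for them is avoided. The argument only asks when such a module vanishes in
    a given degree, so [cohom_vanishes] states this independently of any resolution, by lifting
    torsion elements and shifting dimension. Exactness is then needed only in the form: two
    neighbouring terms vanish, hence so does the term between them. The predicate starts at H^1, so
    that torsion modules vanish at every index of it; H^0 is treated apart. That vanishing rests on
    the Noetherian hypothesis: the torsion part of a graded injective is again injective. In the
    Koszul descent, each passage to the next homological degree raises the cohomological index by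
    one. Vanishing is therefore carried for all indices above c and in all degrees; index c itself,
    in a single degree, is met only at the last step. *)

Section GradedHom.
Variable R : noethGradedRing.
Implicit Types A B C M N : grmod R.

Definition mk_grhom A B (f : A -> B) (f_lin : linear f)
    (f_deg : forall n x, gm_piece A n x -> gm_piece B n (f x)) : grhom A B :=
  @GrHom R A B
    (HB.pack_for {linear A -> B} f (GRing.isLinear.Build R A B *:%R f f_lin))
    f_deg.

Definition gcomp A B C (g : grhom B C) (f : grhom A B) : grhom A C :=
  @GrHom R A C (g \o f) (fun n x Ax => gh_deg g (gh_deg f Ax)).

Lemma gh0 A B (f : grhom A B) : f 0 = 0.
Proof. exact: raddf0. Qed.
Lemma ghN A B (f : grhom A B) x : f (- x) = - f x.
Proof. exact: raddfN. Qed.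
Lemma ghD A B (f : grhom A B) x y : f (x + y) = f x + f y.
Proof. exact: raddfD. Qed.
Lemma ghB A B (f : grhom A B) x y : f (x - y) = f x - f y.
Proof. exact: raddfB. Qed.
Lemma ghZ A B (f : grhom A B) a x : f (a *: x) = a *: f x.
Proof. exact: linearZ. Qed.
Lemma ghP A B (f : grhom A B) a x y : f (a *: x + y) = a *: f x + f y.
Proof. exact: linearP. Qed.

Lemma gh_inj A B (f : grhom A B) : (forall x, f x = 0 -> x = 0) -> injective f.
Proof. exact: raddf_inj. Qed.

Lemma gh_eq A B (f : grhom A B) x y : f x = f y <-> f (x - y) = 0.
Proof. by rewrite ghB; split=> [->|/eqP]; rewrite ?subrr // subr_eq0 => /eqP. Qed.

Lemma grhom_reflects_piece A B (f : grhom A B) n x : injective f ->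
  gm_piece B n (f x) -> gm_piece A n x.
Proof.
move=> inj_f Bfx; have [p pP] := gm_proj A; have [q [_ qE q0 _]] := gm_proj B.
have /inj_f <- : f (p n x) = f x by rewrite (grhom_proj f n pP qE q0) qE.
by have [pM _ _ _] := pP; apply: pM.
Qed.

Lemma grhom_lift_piece A B (f : grhom A B) n y :
  (forall y, exists x, f x = y) -> gm_piece B n y ->
  exists2 x, gm_piece A n x & f x = y.
Proof.
move=> surj_f By; have [x fx] := surj_f y.
have [p pP] := gm_proj A; have [q [_ qE q0 _]] := gm_proj B.
exists (p n x); first by have [pM _ _ _] := pP; apply: pM.
by rewrite (grhom_proj f n pP qE q0) fx qE.
Qed.

Lemma factor_mono A B C (i : grhom A B) (f : grhom C B) : injective i ->
  (forall c, exists a, i a = f c) ->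
  exists g : grhom C A, forall c, i (g c) = f c.
Proof.
move=> inj_i /(_ _)/cid fi; pose g c := projT1 (fi c).
have gE c : i (g c) = f c by exact: projT2 (fi c).
have lin_g : linear g.
  by move=> a x y; apply: inj_i; rewrite ghP !gE ghP.
have deg_g n x : gm_piece C n x -> gm_piece A n (g x).
  by move=> Cx; apply: (grhom_reflects_piece inj_i); rewrite gE; apply: gh_deg.
by exists (mk_grhom lin_g deg_g).
Qed.

Lemma factor_epi A B C (p : grhom A B) (f : grhom A C) :
  (forall b, exists a, p a = b) -> (forall a, p a = 0 -> f a = 0) ->
  exists g : grhom B C, forall a, g (p a) = f a.
Proof.
move=> surj_p pf; pose r b := projT1 (cid (surj_p b)).
have rK b : p (r b) = b by exact: projT2 (cid (surj_p b)).
have fE a a' : p a = p a' -> f a = f a'.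
  move=> paa; apply/eqP; rewrite -subr_eq0 -ghB; apply/eqP/pf.
  by rewrite ghB paa subrr.
have gE a : f (r (p a)) = f a by apply: fE; rewrite rK.
have lin_g : linear (f \o r).
  by move=> a x y; rewrite /= -ghP; apply: fE; rewrite ghP !rK.
have deg_g n x : gm_piece B n x -> gm_piece C n ((f \o r) x).
  move=> /(grhom_lift_piece surj_p) [y Ay <-] /=.
  by rewrite gE; apply: gh_deg.
by exists (mk_grhom lin_g deg_g).
Qed.

Definition short_exact A B C (i : grhom A B) (p : grhom B C) : Prop :=
  [/\ injective i, forall x, p x = 0 <-> exists a, i a = x
    & forall c, exists b, p b = c].

Lemma coker_exact A B (i : grhom A B) : injective i ->
  exists C (p : grhom B C), short_exact i p.
Proof.
move=> inj_i; pose S := gim i.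
have deg_pi n x : gm_piece B n x -> gm_piece (gquot S) n (quot_pi S x).
  by move=> Bx; exists x.
exists (gquot S), (@GrHom R B (gquot S) (quot_pi S) deg_pi); split=> //.
  move=> x /=; rewrite -[0](raddf0 (quot_pi S)) quot_piE subr0.
  by split=> [[a _ ax]|[a ax]]; exists a.
exact: quot_pi_surj.
Qed.

Lemma ses_comp0 A B C (i : grhom A B) (p : grhom B C) a :
  short_exact i p -> p (i a) = 0.
Proof. by move=> [_ ex _]; apply/ex; exists a. Qed.

Lemma third_iso A B C E Q D (i : grhom A B) (p : grhom B C)
    (k : grhom B E) (q : grhom E Q) (j : grhom A E) (r : grhom E D) :
  short_exact i p -> short_exact k q -> short_exact j r ->
  (forall a, k (i a) = j a) ->
  exists (u : grhom C D) (v : grhom D Q),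
    [/\ short_exact u v, forall b, u (p b) = r (k b) & forall e, v (r e) = q e].
Proof.
move=> ip kq jr kij; have [inj_i ex_ip surj_p] := ip.
have [inj_k ex_kq surj_q] := kq; have [inj_j ex_jr surj_r] := jr.
have [|u uE] := @factor_epi _ _ _ p (gcomp r k) surj_p.
  by move=> b /ex_ip [a <-]; rewrite /= kij (ses_comp0 _ jr).
have [|v vE] := @factor_epi _ _ _ r q surj_r.
  by move=> e /ex_jr [a <-]; rewrite -kij (ses_comp0 _ kq).
exists u, v; split=> //; split.
- apply: gh_inj => c; have [b <-] := surj_p c.
  rewrite uE /= => /ex_jr [a]; rewrite -kij => /inj_k <-.
  by rewrite (ses_comp0 _ ip).
- move=> x; have [e <-] := surj_r x; rewrite vE; split.
    by move=> /ex_kq [b <-]; exists (p b); rewrite uE.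
  move=> [c]; have [b <-] := surj_p c; rewrite uE /= => ere.
  have /ex_jr [a] : r (e - k b) = 0 by rewrite ghB -ere subrr.
  rewrite -kij => /esym/eqP; rewrite subr_eq -ghD => /eqP ->.
  by rewrite (ses_comp0 _ kq).
- by move=> c; have [e <-] := surj_q c; exists (r e).
Qed.

(** Here D = E/A, and the new sequence is B/A -> E/A -> E/B. When E is injective, D and Q carry the
    cohomology of A and B one index down, so this sequence drives the dimension shifts below. *)
Lemma third_iso_coker A B C E Q (i : grhom A B) (p : grhom B C)
    (k : grhom B E) (q : grhom E Q) :
  short_exact i p -> short_exact k q ->
  exists D (r : grhom E D) (u : grhom C D) (v : grhom D Q),
    [/\ short_exact (gcomp k i) r, short_exact u v,
        forall b, u (p b) = r (k b) & forall e, v (r e) = q e].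
Proof.
move=> ip kq; have [inj_i _ _] := ip; have [inj_k _ _] := kq.
have [|D [r jr]] := @coker_exact _ _ (gcomp k i).
  by move=> a b /inj_k /inj_i.
have [u [v [uv ur vr]]] := third_iso ip kq jr (fun=> erefl).
by exists D, r, u, v.
Qed.

Section DirectSum.
Variables A B : grmod R.

Let piece n : set (A * B)%type := [set x | gm_piece A n x.1 /\ gm_piece B n x.2].

Let piece_subgroup n : is_subgroup (piece n).
Proof.
split; first by split; [exact: (gm_subgroup A n).1 | exact: (gm_subgroup B n).1].
move=> x y [Ax Bx] [Ay By].
by split; [exact: (gm_subgroup A n).2 | exact: (gm_subgroup B n).2].
Qed.

Let piece_sum : direct_sum piece.
Proof.
have [_ spA inA] := gm_sum A; have [_ spB inB] := gm_sum B.
split=> //.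
- move=> [a b]; have gH := homsum_subgroup piece_subgroup.
  have -> : (a, b) = (a, 0) + (0, b) by congr pair; rewrite ?addr0 ?add0r.
  apply: (subgroupD gH).
    have [s [f [_ Af ->]]] := spA a.
    have -> : (\sum_(i <- s) f i, 0) = \sum_(i <- s) ((f i, 0) : A * B).
      elim: s => [|i s IH]; first by rewrite !big_nil.
      by rewrite !big_cons -IH; congr pair; rewrite /= ?addr0.
    apply: subgroup_sum => // i _; apply: (@homsum1 _ _ _ i) => //; split=> //=.
    exact: (gm_subgroup B i).1.
  have [s [f [_ Bf ->]]] := spB b.
  have -> : (0, \sum_(i <- s) f i) = \sum_(i <- s) ((0, f i) : A * B).
    elim: s => [|i s IH]; first by rewrite !big_nil.
    by rewrite !big_cons -IH; congr pair; rewrite /= ?addr0.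
  apply: subgroup_sum => // i _; apply: (@homsum1 _ _ _ i) => //; split=> //=.
  exact: (gm_subgroup A i).1.
- move=> s f us Pf f0 i si; rewrite [f i]surjective_pairing; congr pair.
    apply: (inA s (fun i => (f i).1)) => // [j|]; first by case: (Pf j).
    by rewrite -(raddf_sum (@fst A B)) f0.
  apply: (inB s (fun i => (f i).2)) => // [j|]; first by case: (Pf j).
  by rewrite -(raddf_sum (@snd A B)) f0.
Qed.

Let piece_act i n (a : R) x :
  gr_piece R i a -> piece n x -> piece (i%:Z + n) (a *: x).
Proof. by move=> Ra [Ax Bx]; split; apply: gm_act. Qed.

Definition gdsum : grmod R := GrMod piece_sum piece_act.

Lemma dsum_exact : exists (i : grhom A gdsum) (p : grhom gdsum B), 
  [/\ short_exact i p, forall a, i a = (a, 0) & forall x, p x = x.2].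
Proof.
have li : linear (fun a : A => (a, 0) : gdsum).
  by move=> a x y; congr pair; rewrite /= ?scaler0 ?addr0.
have lp : linear (fun x : gdsum => x.2) by [].
have di n a : gm_piece A n a -> gm_piece gdsum n (a, 0).
  by move=> Aa; split=> //; exact: (gm_subgroup B n).1.
have dp n (x : gdsum) : gm_piece gdsum n x -> gm_piece B n x.2 by case.
exists (mk_grhom li di), (mk_grhom lp dp); split=> //; split.
- by move=> a a' [].
- move=> [a b] /=; split=> [->|[a' []]//]; by exists a.
- by move=> b; exists (0, b).
Qed.

End DirectSum.

Section Shift.
Variables (k : int) (M : grmod R).

Let piece n : set M := gm_piece M (n - k).

Let piece_sum : direct_sum piece.
Proof.
have [gM spM inM] := gm_sum M; split=> [n|x|s f us Mf f0 i si].
- exact: gM.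
- have [s [f [us Mf ->]]] := spM x.
  exists [seq i + k | i <- s], (fun i => f (i - k)); split=> //.
    by rewrite map_inj_uniq //; apply: addIr.
    by move=> i; apply: Mf.
  by rewrite big_map; apply: eq_bigr => i _; rewrite addrK.
- have := inM [seq j - k | j <- s] (fun j => f (j + k)) _ _ _ (i - k).
  rewrite subrK; apply.
  + by rewrite map_inj_uniq //; apply: addIr.
  + by move=> j; have := Mf (j + k); rewrite /piece addrK.
  + by rewrite big_map -[RHS]f0; apply: eq_bigr => j _; rewrite subrK.
  + exact: map_f.
Qed.

Let piece_act i n (a : R) x :
  gr_piece R i a -> piece n x -> piece (i%:Z + n) (a *: x).
Proof. by move=> Ra Mx; rewrite /piece -addrA; apply: gm_act. Qed.

(* M(-k) *)
Definition gshift : grmod R := GrMod piece_sum piece_act.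

Lemma shift_pieceE n (x : M) : gm_piece gshift n x = gm_piece M (n - k) x.
Proof. by []. Qed.
End Shift.

Definition gshift_hom k A B (f : grhom A B) : grhom (gshift k A) (gshift k B) :=
  @GrHom R (gshift k A) (gshift k B) f (fun n x Ax => gh_deg f Ax).

Lemma shift_exact k A B C (i : grhom A B) (p : grhom B C) :
  short_exact i p -> short_exact (gshift_hom k i) (gshift_hom k p).
Proof. by []. Qed.

Lemma shift_injective k E : gr_injective E -> gr_injective (gshift k E).
Proof.
move=> injE A B i f inj_i.
have df n (x : gshift (- k) A) : gm_piece (gshift (- k) A) n x -> gm_piece E n (f x).
  by rewrite shift_pieceE => /(gh_deg f); rewrite shift_pieceE opprK addrK.
have [g gE] := injE _ _ (gshift_hom (- k) i)
  (@GrHom R (gshift (- k) A) E f df) inj_i.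
have dg n x : gm_piece B n x -> gm_piece (gshift k E) n (g x).
  move=> Bx; rewrite shift_pieceE; apply: gh_deg.
  by rewrite shift_pieceE opprK subrK.
by exists (@GrHom R B (gshift k E) g dg).
Qed.

Lemma retract_injective A E (i : grhom A E) (r : grhom E A) :
  gr_injective E -> (forall a, r (i a) = a) -> gr_injective A.
Proof.
move=> injE ri M N j f inj_j; have [g gE] := injE _ _ j (gcomp i f) inj_j.
by exists (gcomp r g) => x /=; rewrite gE /= ri.
Qed.

(** Injectivity of A splits the sequence, and x - i (r x) induces a section of [p]; thus Q is a
    retract of E. *)
Lemma coker_injective A E Q (i : grhom A E) (p : grhom E Q) :
  short_exact i p -> gr_injective A -> gr_injective E -> gr_injective Q.
Proof.
move=> ip injA injE; have [inj_i ex surj_p] := ip.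
have lid : linear (@id A) by [].
have [r rE] := injA _ _ i (mk_grhom lid (fun _ _ => id)) inj_i.
have lf : linear (fun x => x - i (r x)).
  by move=> a x y; rewrite !ghP /= scalerBr opprD addrACA.
have df n x : gm_piece E n x -> gm_piece E n (x - i (r x)).
  by move=> Ex; apply: (gm_subgroup E n).2 => //; do 2 apply: gh_deg.
have [|g gE] := @factor_epi _ _ _ p (mk_grhom lf df) surj_p.
  by move=> x /ex [a <-] /=; rewrite rE subrr.
apply: (@retract_injective Q E g p injE) => q; have [x <-] := surj_p q.
by rewrite gE /= ghB (ses_comp0 _ ip) subr0.
Qed.

(** As in Schanuel's lemma, P is the direct sum of E and E' modulo the antidiagonal copy of N. It
    compares the cokernels of two embeddings of N. *)
Lemma pushout_exact N E E' Q Q' (i : grhom N E) (p : grhom E Q)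
    (i' : grhom N E') (p' : grhom E' Q') :
  short_exact i p -> short_exact i' p' ->
  exists P (u : grhom E' P) (v : grhom P Q) (u' : grhom E P) (v' : grhom P Q'),
    short_exact u v /\ short_exact u' v'.
Proof.
move=> ip ip'; have [inj_i ex surj] := ip; have [inj_i' ex' surj'] := ip'.
pose S := gdsum E E'.
have lk : linear (fun x => (i x, - i' x) : S).
  by move=> a x y; congr pair; rewrite ghP // opprD -scalerN.
have dk n x : gm_piece N n x -> gm_piece S n (i x, - i' x).
  move=> Nx; split; first exact: gh_deg.
  by apply: subgroupN; [exact: gm_subgroup | exact: gh_deg].
have [|P [q kq]] := @coker_exact _ _ (mk_grhom lk dk).
  by move=> x y [/inj_i].
have [inj_k exk surj_q] := kq.
have lu : linear (fun x : E' => q (0, x)).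
  by move=> a x y; rewrite -ghP; congr (q _); congr pair;
    rewrite /= ?scaler0 ?addr0.
have du n x : gm_piece E' n x -> gm_piece P n (q (0, x)).
  by move=> Ex; apply: gh_deg; split=> //; exact: (gm_subgroup E n).1.
have lu' : linear (fun x : E => q (x, 0)).
  by move=> a x y; rewrite -ghP; congr (q _); congr pair;
    rewrite /= ?scaler0 ?addr0.
have du' n x : gm_piece E n x -> gm_piece P n (q (x, 0)).
  by move=> Ex; apply: gh_deg; split=> //; exact: (gm_subgroup E' n).1.
have lf : linear (fun x : S => p x.1) by move=> a x y; rewrite ghP.
have df n (x : S) : gm_piece S n x -> gm_piece Q n (p x.1).
  by move=> [Ex _]; apply: gh_deg.
have lf' : linear (fun x : S => p' x.2) by move=> a x y; rewrite ghP.
have df' n (x : S) : gm_piece S n x -> gm_piece Q' n (p' x.2).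
  by move=> [_ Ex]; apply: gh_deg.
have [|v vE] := @factor_epi _ _ _ q (mk_grhom lf df) surj_q.
  by move=> x /exk [a <-] /=; rewrite (ses_comp0 _ ip).
have [|v' vE'] := @factor_epi _ _ _ q (mk_grhom lf' df') surj_q.
  by move=> x /exk [a <-] /=; rewrite ghN (ses_comp0 _ ip') oppr0.
exists P, (mk_grhom lu du), v, (mk_grhom lu' du'), v'; split; split.
- apply: gh_inj => x /= /exk [a [ia <-]].
  by rewrite (inj_i a 0) ?gh0 ?oppr0.
- move=> x; have [[e e'] <-] := surj_q x; rewrite vE /=; split.
    move=> /ex [a <-]; exists (e' + i' a) => /=; apply/(gh_eq q)/exk.
    exists (- a).
    by rewrite /= !ghN opprK; congr pair; rewrite /= ?sub0r // addrC addKr.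
  move=> [y] /= /(gh_eq q)/exk [a [+ _]].
  by rewrite /= sub0r => /(congr1 p); rewrite (ses_comp0 _ ip) ghN
    => /esym/eqP; rewrite oppr_eq0 => /eqP.
- by move=> c; have [e <-] := surj c; exists (q (e, 0)); rewrite vE.
- apply: gh_inj => x /= /exk [a [<- /eqP]].
  by rewrite oppr_eq0 => /eqP ia; rewrite (inj_i' a 0) ?gh0.
- move=> x; have [[e e'] <-] := surj_q x; rewrite vE' /=; split.
    move=> /ex' [a <-]; exists (e + i a) => /=; apply/(gh_eq q)/exk; exists a => /=.
    by congr pair; rewrite /= ?sub0r // addrC addKr.
  move=> [y] /= /(gh_eq q)/exk [a [_]].
  by rewrite /= sub0r => /oppr_inj <-; rewrite (ses_comp0 _ ip').
- by move=> c; have [e <-] := surj' c; exists (q (0, e)); rewrite vE'.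
Qed.

Lemma grhom_image A B (f : grhom A B) : exists I (q : grhom A I) (i : grhom I B),
  [/\ short_exact (ginc (gker f)) q, injective i & forall a, i (q a) = f a].
Proof.
have [|q qE] := @factor_mono _ _ A (ginc (gim f)) f val_inj.
  move=> a; have ia : gim f (f a) by exists a.
  by exists (to_sub ia).
exists (gsub (gim f)), q, (ginc (gim f)); split=> //.
split; first exact: val_inj.
- move=> a; split=> [qa|[z <-]].
    have fa : gker f a by rewrite /= -qE qa gh0.
    by exists (to_sub fa).
  apply: val_inj; rewrite -[LHS]/(ginc (gim f) (q (ginc (gker f) z))) qE.
  exact: (@sub_typeP _ _ (gker f) z).
- move=> y; have [a _ ay] := @sub_typeP _ _ (gim f) y.
  by exists a; apply: val_inj; rewrite -[LHS]/(ginc (gim f) (q a)) qE.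
Qed.

End GradedHom.

(** * Vanishing of local cohomology in one degree *)

Section Vanishing.
Variables (R : noethGradedRing) (s : seq R).
Implicit Types A B C E N Q : grmod R.

(* The (s)-torsion elements, (s) being the ideal generated by s. *)
Definition power_torsion N (x : N) : Prop :=
  forall g, g \in s -> exists k, g ^+ k *: x = 0.

Lemma expr_scale0_leq N g k m (x : N) : (k <= m)%N -> g ^+ k *: x = 0 ->
  g ^+ m *: x = 0.
Proof. by move=> /subnK <- gx; rewrite exprD -scalerA gx scaler0. Qed.

Lemma power_torsion0 N : power_torsion (0 : N).
Proof. by move=> g _; exists 0%N; rewrite scaler0. Qed.

Lemma power_torsionD N (x y : N) :
  power_torsion x -> power_torsion y -> power_torsion (x + y).
Proof.
move=> tx ty g gs; have [k gx] := tx g gs; have [m gy] := ty g gs.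
exists (maxn k m); rewrite scalerDr.
by rewrite (expr_scale0_leq (leq_maxl k m) gx)
  (expr_scale0_leq (leq_maxr k m) gy) addr0.
Qed.

Lemma power_torsionZ N a (x : N) : power_torsion x -> power_torsion (a *: x).
Proof.
move=> tx g /tx [k gx]; exists k.
by rewrite scalerA mulrC -scalerA gx scaler0.
Qed.

Lemma power_torsionB N (x y : N) :
  power_torsion x -> power_torsion y -> power_torsion (x - y).
Proof.
by move=> tx ty; rewrite -scaleN1r; apply/power_torsionD/power_torsionZ.
Qed.

Lemma power_torsion_hom N Q (f : grhom N Q) x :
  power_torsion x -> power_torsion (f x).
Proof. by move=> tx g /tx [k gx]; exists k; rewrite -ghZ gx gh0. Qed.

Lemma power_torsion_inj N Q (f : grhom N Q) x : injective f ->
  power_torsion (f x) -> power_torsion x.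
Proof.
move=> inj_f tx g /tx [k gx]; exists k.
by apply: inj_f; rewrite ghZ gx gh0.
Qed.

Lemma power_torsion_ext A B C (i : grhom A B) (p : grhom B C) b :
  short_exact i p -> (forall a : A, power_torsion a) ->
  power_torsion (p b) -> power_torsion b.
Proof.
move=> [_ ex _] tA tb g gs; have [k] := tb g gs.
rewrite -ghZ => /ex [a ia]; have [m ga] := tA a g gs.
by exists (m + k)%N; rewrite exprD -scalerA -ia -ghZ ga gh0.
Qed.

(* H^1(N)_n = 0, for the local cohomology with support in the ideal (s). *)
Definition torsion_lifts (n : int) N : Prop :=
  forall B C (i : grhom N B) (p : grhom B C), short_exact i p ->
  forall c, gm_piece C n c -> power_torsion c ->
  exists b, [/\ gm_piece B n b, power_torsion b & p b = c].

(* H^(j+1)(N)_n = 0, by dimension shifting along all embeddings into injective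
   objects. *)
Fixpoint cohom_vanishes (j : nat) (n : int) N : Prop :=
  if j is j'.+1 then
    forall E Q (i : grhom N E) (p : grhom E Q), gr_injective E ->
    short_exact i p -> cohom_vanishes j' n Q
  else torsion_lifts n N.

Lemma injective_hull_exact N : exists E Q (i : grhom N E) (p : grhom E Q),
  gr_injective E /\ short_exact i p.
Proof.
have [E [injE [i inj_i]]] := enough_gr_injectives N.
by have [Q [p ip]] := coker_exact inj_i; exists E, Q, i, p.
Qed.

(** Any extension B of C by N is the pullback of E along a map C -> Q, because [i] extends to B. An
    element of B is torsion once its images in E and in C are, so a torsion lift in E yields one in
    B. *)
Lemma torsion_lifts_test n N E Q (i : grhom N E) (p : grhom E Q) :
  gr_injective E -> short_exact i p ->
  (forall c, gm_piece Q n c -> power_torsion c ->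
    exists b, [/\ gm_piece E n b, power_torsion b & p b = c]) ->
  torsion_lifts n N.
Proof.
move=> injE ip lift_p B C i' p' ip'.
have [inj_i ex surj_p] := ip; have [inj_i' ex' surj_p'] := ip'.
have [h hE] := injE _ _ i' i inj_i'.
have [|h' hE'] := @factor_epi _ _ _ _ p' (gcomp p h) surj_p'.
  by move=> x /ex' [a <-] /=; rewrite hE (ses_comp0 _ ip).
move=> c Cc tc; have [b Bb pb] := grhom_lift_piece surj_p' Cc.
have [|e [Ee te pe]] := lift_p (h' c) (gh_deg _ Cc).
  exact: power_torsion_hom.
have /ex [z iz] : p (h b - e) = 0.
  by rewrite ghB pe -pb hE' /= subrr.
have Nz : gm_piece N n z.
  apply: (grhom_reflects_piece inj_i); rewrite iz.
  by apply: (gm_subgroup E n).2 => //; apply: gh_deg.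
exists (b - i' z); split.
- by apply: (gm_subgroup B n).2 => //; apply: gh_deg.
- have hbz : h (b - i' z) = e by rewrite ghB hE iz opprB addrC subrK.
  move=> g gs; have [k gc] := tc g gs; have [m ge] := te g gs.
  have /ex' [w iw] : p' (g ^+ k *: (b - i' z)) = 0.
    by rewrite ghZ ghB pb (ses_comp0 _ ip') subr0.
  exists (m + k)%N; rewrite exprD -scalerA -iw -ghZ.
  suff -> : g ^+ m *: w = 0 by rewrite gh0.
  apply: inj_i; rewrite ghZ -hE iw ghZ hbz gh0.
  by rewrite scalerA mulrC -scalerA ge scaler0.
- by rewrite ghB pb (ses_comp0 _ ip') subr0.
Qed.

Lemma injective_vanishes j n E : gr_injective E -> cohom_vanishes j n E.
Proof.
elim: j E => [|j IH] E injE; last first.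
  by move=> E' Q i p injE' ip; apply: IH; apply: coker_injective ip _ _.
move=> B C i p ip c Cc tc; have [inj_i ex surj_p] := ip.
have lid : linear (@id E) by [].
have [r rE] := injE _ _ i (mk_grhom lid (fun _ _ => id)) inj_i.
have [b Bb pb] := grhom_lift_piece surj_p Cc.
(* The sequence splits, and this is the lift of [c] in the complement ker r, which [p] maps
   injectively to C; so it inherits torsion from [c]. *)
exists (b - i (r b)); split.
- by apply: (gm_subgroup B n).2 => //; do 2 apply: gh_deg.
- move=> g /tc [k gc]; exists k.
  have /ex [z iz] : p (g ^+ k *: b) = 0 by rewrite ghZ pb.
  by rewrite scalerBr -!ghZ -iz rE subrr.
- by rewrite ghB pb (ses_comp0 _ ip) subr0.
Qed.

(* For a short exact sequence 0 -> A -> B -> C -> 0: exactness of the long exact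
   sequence at H^(j+1)(B), H^(j+1)(C) and H^(j+2)(A). *)
Let exact_mid j := forall n A B C (i : grhom A B) (p : grhom B C),
  short_exact i p -> cohom_vanishes j n A -> cohom_vanishes j n C ->
  cohom_vanishes j n B.
Let exact_right j := forall n A B C (i : grhom A B) (p : grhom B C),
  short_exact i p -> cohom_vanishes j n B -> cohom_vanishes j.+1 n A ->
  cohom_vanishes j n C.
Let exact_left j := forall n A B C (i : grhom A B) (p : grhom B C),
  short_exact i p -> cohom_vanishes j n C -> cohom_vanishes j.+1 n B ->
  cohom_vanishes j.+1 n A.
Let one_injective j := forall n N E Q (i : grhom N E) (p : grhom E Q),
  gr_injective E -> short_exact i p -> cohom_vanishes j n Q ->
  cohom_vanishes j.+1 n N.

(** An extension X -> Y with kernel B factors through D = X/A: [y] is lifted first along D -> Y,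
    with kernel C, then along X -> D, with kernel A. *)
Let exact_mid0 : exact_mid 0%N.
Proof.
move=> n A B C i p ip /= vA vC X Y k q kq y Yy ty.
have [D [r [u [v [jr uv _ vr]]]]] := third_iso_coker ip kq.
have [w [Dw tw vw]] := vC _ _ _ _ uv y Yy ty.
have [x [Xx tx rx]] := vA _ _ _ _ jr w Dw tw.
by exists x; split=> //; rewrite -vr rx.
Qed.

(** With D = E/A, vanishing of H^2(A) gives that of H^1(D). Embedding D, hence C, in an injective F
    makes Y = F/C an extension of G = F/D by Q = E/B. A torsion element of Y is lifted to F up to an
    element of Q by H^1(D) = 0, and that element is lifted to E by H^1(B) = 0. *)
Let exact_right0 : exact_right 0%N.
Proof.
move=> n A B C i p ip vB vA.
have [E [Q [k [q [injE kq]]]]] := injective_hull_exact B.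
have [D [r [u [v [jr uv _ vr]]]]] := third_iso_coker ip kq.
have vD : torsion_lifts n D := vA _ _ _ _ injE jr.
have [F [G [f [g [injF fg]]]]] := injective_hull_exact D.
have [Y [h [u' [v' [uh uv' u'v v'h]]]]] := third_iso_coker uv fg.
apply: (torsion_lifts_test injF uh) => y Yy ty.
have [x [Fx tx gx]] := vD _ _ _ _ fg _ (gh_deg v' Yy) (power_torsion_hom v' ty).
have [inj_u' ex_uv' _] := uv'.
have /ex_uv' [z u'z] : v' (y - h x) = 0 by rewrite ghB v'h gx subrr.
have Yz : gm_piece Y n (u' z).
  by rewrite u'z; apply: (gm_subgroup Y n).2 => //; apply: gh_deg.
have tz : power_torsion z.
  apply: (power_torsion_inj inj_u'); rewrite u'z.
  by apply: power_torsionB => //; apply: power_torsion_hom.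
have [e [Ee te qe]] := vB _ _ _ _ kq z (grhom_reflects_piece inj_u' Yz) tz.
exists (x + f (r e)); split.
- by apply: subgroupD => //; [exact: gm_subgroup | do 2 apply: gh_deg].
- by apply: power_torsionD => //; do 2 apply: power_torsion_hom.
- by rewrite ghD -u'v vr qe u'z addrC subrK.
Qed.

(** The pushout P of two embeddings is an extension of Q by the injective E', so it vanishes along
    with Q; it is also an extension of Q' by the injective E, so Q' vanishes along with it. *)
Let one_injective_of j : exact_mid j -> exact_right j -> one_injective j.
Proof.
move=> mid right n N E Q i p injE ip vQ E' Q' i' p' injE' ip'.
have [P [u [v [u' [v' [uv uv']]]]]] := pushout_exact ip ip'.
apply: (right _ _ _ _ _ _ uv'); last exact: injective_vanishes.
by apply: (mid _ _ _ _ _ _ uv) => //; apply: injective_vanishes.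
Qed.

(** Replacing A -> B -> C by C -> E/A -> E/B rotates the long exact sequence: [exact_left] at j
    comes from [exact_mid] at j, and below, [exact_mid] at j + 1 from [exact_right] at j, and
    [exact_right] at j + 1 from [exact_left] at j. *)
Let exact_left_of j : exact_mid j -> exact_right j -> exact_left j.
Proof.
move=> mid right n A B C i p ip vC vB.
have [E [Q [k [q [injE kq]]]]] := injective_hull_exact B.
have [D [r [u [v [jr uv _ vr]]]]] := third_iso_coker ip kq.
apply: (one_injective_of mid right injE jr).
exact: mid uv vC (vB _ _ _ _ injE kq).
Qed.

Let exact_mid_step j : exact_right j -> exact_mid j.+1.
Proof.
move=> right n A B C i p ip vA vC E Q k q injE kq.
have [D [r [u [v [jr uv _ _]]]]] := third_iso_coker ip kq.
exact: right uv (vA _ _ _ _ injE jr) vC.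
Qed.

Let exact_right_step j : exact_mid j -> exact_right j -> exact_right j.+1.
Proof.
move=> mid right n A B C i p ip vB vA.
have [E [Q [k [q [injE kq]]]]] := injective_hull_exact B.
have [D [r [u [v [jr uv _ vr]]]]] := third_iso_coker ip kq.
exact: (exact_left_of mid right) uv (vB _ _ _ _ injE kq) (vA _ _ _ _ injE jr).
Qed.

Let exact_both j : exact_mid j /\ exact_right j.
Proof.
elim: j => [|j [mid right]]; first by split.
by split; [apply: exact_mid_step | apply: exact_right_step].
Qed.

Lemma vanishes_mid j n A B C (i : grhom A B) (p : grhom B C) :
  short_exact i p -> cohom_vanishes j n A -> cohom_vanishes j n C ->
  cohom_vanishes j n B.
Proof. by case: (exact_both j) => mid _; apply: mid. Qed.

Lemma vanishes_right j n A B C (i : grhom A B) (p : grhom B C) :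
  short_exact i p -> cohom_vanishes j n B -> cohom_vanishes j.+1 n A ->
  cohom_vanishes j n C.
Proof. by case: (exact_both j) => _ right; apply: right. Qed.

Lemma vanishes_one_injective j n N E Q (i : grhom N E) (p : grhom E Q) :
  gr_injective E -> short_exact i p ->
  cohom_vanishes j.+1 n N <-> cohom_vanishes j n Q.
Proof.
move=> injE ip; split=> [vN|]; first exact: vN injE ip.
by have [mid right] := exact_both j; apply: (one_injective_of mid right) ip.
Qed.

Lemma vanishes_dsum j n A B : cohom_vanishes j n A -> cohom_vanishes j n B ->
  cohom_vanishes j n (gdsum A B).
Proof.
move=> vA vB; have [i [p [ip _ _]]] := dsum_exact A B.
exact: vanishes_mid ip vA vB.
Qed.

Lemma vanishes_unshift j n k N :
  cohom_vanishes j n (gshift k N) -> cohom_vanishes j (n - k) N.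
Proof.
elim: j n N => [|j IH] n N vN.
  move=> B C i p ip c Cc tc.
  by have [b [Bb tb pb]] := vN _ _ _ _ (shift_exact k ip) c Cc tc; exists b.
move=> E Q i p injE ip; apply: IH.
exact: (vN _ _ _ _ (@shift_injective R k E injE) (shift_exact k ip)).
Qed.

Lemma vanishes_shift j n k N :
  cohom_vanishes j n N -> cohom_vanishes j (n + k) (gshift k N).
Proof.
move=> vN; case: j vN => [|j] vN.
  move=> B C i p ip c Cc tc.
  have di m x : gm_piece N m x -> gm_piece (gshift (- k) B) m (i x).
    by move=> Nx; rewrite shift_pieceE opprK; apply: gh_deg;
      rewrite shift_pieceE addrK.
  have Cc' : gm_piece (gshift (- k) C) n c by rewrite shift_pieceE opprK.
  have [b [Bb tb pb]] := vN (gshift (- k) B) (gshift (- k) C)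
    (@GrHom R N (gshift (- k) B) i di) (gshift_hom (- k) p) ip c Cc' tc.
  by exists b; split=> //; move: Bb; rewrite shift_pieceE opprK.
move=> E Q i p injE ip; rewrite -[k in n + k]opprK; apply: vanishes_unshift.
have di m x : gm_piece N m x -> gm_piece (gshift (- k) E) m (i x).
  by move=> Nx; rewrite shift_pieceE opprK; apply: gh_deg;
    rewrite shift_pieceE addrK.
exact: (vN (gshift (- k) E) (gshift (- k) Q)
  (@GrHom R N (gshift (- k) E) i di) (gshift_hom (- k) p)
  (@shift_injective R (- k) E injE) ip).
Qed.

End Vanishing.

(** * Torsion modules are acyclic *)

Lemma noetherian_chain (A : comNzRingType) (F : nat -> set A) :
  noetherian A -> (forall n, is_ideal (F n)) -> (forall n, F n `<=` F n.+1) ->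
  exists m, forall n, F n `<=` F m.
Proof.
move=> noethA idF incF.
have le_F m n : (m <= n)%N -> F m `<=` F n.
  by move=> /subnK <-; elim: (n - m)%N => [//|k IH] x /IH; apply: incF.
have idU : is_ideal [set x | exists n, F n x].
  split.
  - by exists 0%N; case: (idF 0%N).
  - move=> x y [n Fx] [m Fy]; exists (maxn n m).
    case: (idF (maxn n m)) => _ FD _; apply: FD.
      exact: le_F (leq_maxl n m) _ Fx.
    exact: le_F (leq_maxr n m) _ Fy.
  - by move=> a x [n Fx]; exists n; case: (idF n) => _ _; apply.
have [t tE] := noethA _ idU.
have [m tF] : exists m, forall x, x \in t -> F m x.
  have : forall x, x \in t -> exists n, F n x.
    by move=> x xt; rewrite -[exists n, F n x]/([set x | exists n, F n x] x) tE;
      apply: sub_ideal_gen.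
  elim: t {tE} => [|y t IH] Ft; first by exists 0%N.
  have [n Fy] : exists n, F n y by apply: Ft; rewrite inE eqxx.
  have [|m tF] := IH; first by move=> x xt; apply: Ft; rewrite inE xt orbT.
  exists (maxn n m) => x; rewrite inE => /orP [/eqP ->|/tF].
    exact: le_F (leq_maxl n m) _ Fy.
  exact: le_F (leq_maxr n m) _.
exists m => n x Fx; have : [set x | exists n, F n x] x by exists n.
by rewrite tE; apply.
Qed.

Lemma gm_proj_scale (R : noethGradedRing) (N : grmod R)
    (p : int -> {additive N -> N}) t c m y :
  [/\ forall n x, gm_piece N n (p n x),
      forall n x, gm_piece N n x -> p n x = x,
      forall n m x, gm_piece N n x -> m != n -> p m x = 0 &
      forall x, exists2 s, uniq s & x = \sum_(n <- s) p n x] ->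
  gr_piece R t c -> p (t%:Z + m) (c *: y) = c *: p m y.
Proof.
move=> pP Rc; have [pM pE p0 _] := pP.
have -> : p (t%:Z + m) (c *: y) = p (t%:Z + m) (c *: p m y).
  apply: (proj_only (h := p (t%:Z + m) \o ( *:%R c)) pP) => k z Mz km /=.
  by apply: p0 (gm_act Rc Mz) _; apply: contraNneq km => /addrI ->.
by apply: pE; apply: gm_act.
Qed.

Section TorsionModules.
Variables (R : noethGradedRing) (s : seq R).
Hypothesis s_deg1 : forall g, g \in s -> gr_piece R 1%N g.
Implicit Types A B C E N Q : grmod R.

Lemma expr_deg1 g k : g \in s -> gr_piece R k (g ^+ k).
Proof.
move=> gs; elim: k => [|k IH]; first exact: gr_one.
by rewrite exprS -add1n; apply: gr_mul => //; apply: s_deg1.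
Qed.

Lemma power_torsion_homsum N (x : N) : power_torsion s x ->
  homsum (fun n => [set y : N | power_torsion s y /\ gm_piece N n y]) x.
Proof.
move=> tx; have [p pP] := gm_proj N; have [pM _ _ /(_ x) [t ut xE]] := pP.
exists t, (fun n => p n x); split=> // n; split=> // g gs.
have [k gx] := tx g gs; exists k.
by rewrite -(gm_proj_scale _ _ pP (expr_deg1 k gs)) gx raddf0.
Qed.

Definition power_torsion_sub N : hsubmod N :=
  @HSubmod R N (Submod (@power_torsion0 R s N) (@power_torsionD R s N)
    (@power_torsionZ R s N)) (@power_torsion_homsum N).

Section Essential.
Variables (A B T : grmod R) (i : grhom A B) (f : grhom A T).
Hypothesis inj_i : injective i.
Hypothesis torT : forall x : T, power_torsion s x.

(* A maximal graded submodule C of B meeting A in ker f makes A / ker f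
   essential in B / C; an essential extension of a torsion module is torsion
   because the annihilators of g^k b modulo C stabilize. *)
Lemma maximal_kernel_extension : exists C : hsubmod B,
  (forall a, C (i a) <-> f a = 0) /\
  forall b g, g \in s -> exists k, C (g ^+ k *: b).
Proof.
have [p pP] := gm_proj B; have [pB pE p0 ps] := pP.
have [q qP] := gm_proj A; have [qA qE q0 qs] := qP.
have [r [rT rE r0 _]] := gm_proj T.
pose good (C : set B) := [/\ C 0, forall x y, C x -> C y -> C (x + y),
  forall a x, C x -> C (a *: x), forall n x, C x -> C (p n x)
  & forall a, C (i a) <-> f a = 0].
pose P (C : set B) := C = set0 \/ good C.
have [F FP totF|C [PC Cmax]] := @Zorn_bigcup _ P.
  have goodF (K : set B) x : F K -> K x -> good K.
    by move=> FK Kx; case: (FP _ FK) => // K0; move: Kx; rewrite K0.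
  have [[C0 [x0 [FC0 Cx0]]]|F0] := pselect (exists (K : set B) x, F K /\ K x); last first.
    by left; rewrite -subset0 => x [C FC Cx]; apply: F0; exists C, x.
  have [C00 _ _ _ C0E] := goodF _ _ FC0 Cx0; right; split.
  - by exists C0.
  - move=> x y [K FK Kx] [K' FK' Ky].
    have [KK|KK] := totF _ _ FK FK'.
      by have [_ KD _ _ _] := goodF _ _ FK' Ky; exists K' => //; apply/KD/Ky/KK.
    by have [_ KD _ _ _] := goodF _ _ FK Kx; exists K => //; apply: KD => //; apply: KK.
  - move=> a x [K FK Kx]; have [_ _ KZ _ _] := goodF _ _ FK Kx.
    by exists K => //; apply: KZ.
  - move=> n x [K FK Kx]; have [_ _ _ Kp _] := goodF _ _ FK Kx.
    by exists K => //; apply: Kp.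
  - move=> a; split=> [[K FK Ka]|fa].
      by have [_ _ _ _ KE] := goodF _ _ FK Ka; apply/KE.
    by exists C0 => //; apply/C0E.
have gdC : good C.
  case: PC => // C0; exfalso.
  pose K : set B := [set i a | a in [set a | f a = 0]].
  have K0 : K 0 by exists 0; rewrite ?gh0 //= gh0.
  apply: (Cmax K).
    by rewrite C0; split; [exact: sub0set | move=> /(_ _ K0)].
  right; split=> //.
  - move=> _ _ [a /= fa <-] [b /= fb <-]; exists (a + b); rewrite ?ghD //=.
    by rewrite ghD fa fb addr0.
  - by move=> c _ [a /= fa <-]; exists (c *: a); rewrite ?ghZ //= ghZ fa scaler0.
  - move=> n _ [a /= fa <-]; exists (q n a).
      by rewrite /= (grhom_proj f n qP rE r0) fa raddf0.
    by rewrite (grhom_proj i n qP pE p0).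
  - by move=> a; split=> [[b /= fb /inj_i <-]|fa] //; exists a.
have [C0 CD CZ Cp CE] := gdC.
have homC x : C x -> homsum (fun n => [set y | C y /\ gm_piece B n y]) x.
  move=> Cx; have [t ut xE] := ps x.
  by exists t, (fun n => p n x); split=> // n; split=> //; apply: Cp.
have CB x y : C x -> C y -> C (x - y).
  by move=> Cx Cy; apply: CD => //; rewrite -scaleN1r; apply: CZ.
exists (@HSubmod R B (Submod C0 CD CZ) homC); split=> //= b0 g gs.
suff homo b n : gm_piece B n b -> exists k, C (g ^+ k *: b).
  have [t _ ->] := ps b0; elim: t => [|n t [k IH]].
    by exists 0%N; rewrite big_nil scaler0.
  have [m Cm] := homo _ _ (pB n b0); exists (k + m)%N.
  rewrite big_cons scalerDr; apply: CD; rewrite exprD -scalerA; first exact: CZ.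
  by rewrite scalerA mulrC -scalerA; apply: CZ.
move=> Bb; pose ann k : set R := [set a | C (a *: (g ^+ k *: b))].
have [||m mP] := @noetherian_chain R ann (gr_noeth (n := R)).
- move=> k; split; first by rewrite /ann /= scale0r.
    by move=> x y Cx Cy; rewrite /ann /= scalerDl; apply: CD.
  by move=> a x Cx; rewrite /ann /= -scalerA; apply: CZ.
- move=> k a Ca; rewrite /ann /= exprS.
  by rewrite !scalerA mulrCA -scalerA -scalerA; apply: CZ.
exists m; apply: contrapT => nCb; set y := g ^+ m *: b in nCb.
have By : gm_piece B (m%:Z + n) y by apply: gm_act => //; apply: expr_deg1.
pose K : set B := [set x | exists c a, C c /\ x = c + a *: y].
apply: (Cmax K).
  split; first by move=> c Cc; exists c, 0; rewrite scale0r addr0.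
  by move=> KC; apply: nCb; apply: KC; exists 0, 1; rewrite scale1r add0r.
right; split.
- by exists 0, 0; rewrite scale0r addr0.
- move=> _ _ [c [a [Cc ->]]] [c' [a' [Cc' ->]]]; exists (c + c'), (a + a').
  by split; [apply: CD | rewrite scalerDl addrACA].
- move=> d _ [c [a [Cc ->]]]; exists (d *: c), (d * a).
  by split; [apply: CZ | rewrite scalerDr scalerA].
- move=> k _ [c [a [Cc ->]]].
  have [_ /(_ a) [t [h [ut Rh ->]]] _] := gr_sum R.
  exists (p k c), (\sum_(j <- t) if j%:Z + (m%:Z + n) == k then h j else 0).
  split; first exact: Cp.
  rewrite raddfD; congr (_ + _); rewrite !scaler_suml raddf_sum.
  apply: eq_bigr => j _; have Bh := gm_act (Rh j) By.
  case: eqP => [<-|/eqP jk]; first by rewrite pE.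
  by rewrite scale0r (p0 _ _ _ Bh) // eq_sym.
- move=> a; split=> [[c [d [Cc iaE]]]|/CE Ca]; last first.
    by exists (i a), 0; rewrite scale0r addr0.
  have [k gfa] := torT (f a) gs.
  (* Multiplying i a = c + d y by g^k puts i (g^k a), hence g^k d y, in C. So [d] annihilates
     g^(k+m) b modulo C and, the chain of annihilators being stationary from [m] on, already
     annihilates [y]. *)
  have Cd : C (d *: y).
    apply: (mP (k + m)%N); rewrite /ann /= exprD -scalerA -/y.
    have -> : d *: (g ^+ k *: y) = i (g ^+ k *: a) - g ^+ k *: c.
      rewrite ghZ iaE scalerDr [RHS]addrAC subrr add0r.
      by rewrite [LHS]scalerA [RHS]scalerA [d * _]mulrC.
    apply: CB; last exact: CZ.
    by apply/CE; rewrite ghZ.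
  by apply/CE; rewrite iaE; apply: CD.
Qed.
End Essential.

(** An extension of [f] from A to B with values in E may leave the torsion part. Instead B is first
    divided by C, which meets A in ker f and has torsion quotient; any map from B/C to E then lands
    in the torsion part. *)
Lemma power_torsion_sub_injective E :
  gr_injective E -> gr_injective (gsub (power_torsion_sub E)).
Proof.
move=> injE A B i f inj_i; pose T := gsub (power_torsion_sub E).
have inj_inc : injective (ginc (power_torsion_sub E)) by exact: val_inj.
have torT (x : T) : power_torsion s x.
  exact: (power_torsion_inj inj_inc (@sub_typeP _ _ (power_torsion_sub E) x)).
have [C [CE Ctor]] := maximal_kernel_extension f inj_i torT.
have inj_C : injective (ginc C) by exact: val_inj.
have [D [pi piP]] := coker_exact inj_C; have [_ ex_pi surj_pi] := piP.
have piE x : pi x = 0 <-> C x.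
  split=> [/ex_pi [c <-]|Cx]; first exact: sub_typeP.
  by apply/ex_pi; exists (to_sub Cx).
pose S := gim (gcomp pi i).
have [|j jE] := @factor_mono _ _ _ A (ginc S) (gcomp pi i) val_inj.
  move=> a; have Sa : S (gcomp pi i a) by exists a.
  by exists (to_sub Sa).
have surj_j (y : gsub S) : exists a, j a = y.
  have [a _ ay] := sub_typeP y; exists a.
  by apply: val_inj; rewrite -[LHS]/(ginc S (j a)) jE.
have [|h hE] := @factor_epi _ _ _ _ j (gcomp (ginc (power_torsion_sub E)) f) surj_j.
  move=> a ja; have /piE/CE fa : pi (i a) = 0.
    by rewrite -[LHS]/(gcomp pi i a) -jE ja gh0.
  by rewrite /= fa.
have [e eE] := injE _ _ (ginc S) h val_inj.
have [|g gE] := @factor_mono _ _ _ B (ginc (power_torsion_sub E)) (gcomp e pi) val_inj.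
  move=> b; have tb : power_torsion_sub E (e (pi b)).
    apply: power_torsion_hom => u us; have [k Ck] := Ctor b u us.
    by exists k; rewrite -ghZ; apply/piE.
  by exists (to_sub tb).
exists g => a; apply: val_inj.
rewrite -[LHS]/(ginc (power_torsion_sub E) (g (i a))) gE /=.
by rewrite -[pi (i a)]/(gcomp pi i a) -jE eE hE.
Qed.

(** For H^1, every homogeneous lift of a torsion element is torsion. For the shift, N lies in the
    torsion part T of E, and E/N is an extension of E/T, which is injective, by T/N, which is
    torsion. *)
Lemma torsion_module_vanishes j n N : (forall x : N, power_torsion s x) ->
  cohom_vanishes s j n N.
Proof.
elim: j N => [|j IH] N torN.
  move=> B C i p ip c Cc tc; have [_ _ surj_p] := ip.
  have [b Bb pb] := grhom_lift_piece surj_p Cc.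
  by exists b; split=> //; apply: (power_torsion_ext ip torN); rewrite pb.
move=> E Q i p injE ip; have [inj_i ex_i surj_p] := ip.
pose T := gsub (power_torsion_sub E).
have inj_inc : injective (ginc (power_torsion_sub E)) by exact: val_inj.
have [|k kE] := @factor_mono _ _ _ N (ginc (power_torsion_sub E)) i inj_inc.
  move=> x; have tx : power_torsion_sub E (i x) by apply: power_torsion_hom.
  by exists (to_sub tx).
have [|C [q kq]] := @coker_exact _ _ _ k.
  by move=> x y kxy; apply: inj_i; rewrite -!kE kxy.
have [G [h incP]] := coker_exact inj_inc.
have [u [v [uv _ _]]] := third_iso kq incP ip kE.
apply: (vanishes_mid uv).
  apply: IH => c; have [_ _ /(_ c) [t <-]] := kq.
  apply/power_torsion_hom/(power_torsion_inj inj_inc).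
  exact: (@sub_typeP _ _ (power_torsion_sub E) t).
apply: injective_vanishes; apply: (coker_injective incP) => //.
exact: power_torsion_sub_injective.
Qed.

End TorsionModules.

(** * The Koszul complex *)

Section Koszul.
Variables (R : noethGradedRing) (M : grmod R).

Let deg1 := {y : R | gr_piece R 1%N y}.

Definition gzero_map (A B : grmod R) : grhom A B.
Proof.
refine (@mk_grhom R A B (fun=> 0) _ _).
  by move=> a x y; rewrite scaler0 addr0.
by move=> n _ _; exact: (gm_subgroup B n).1.
Defined.

Definition gmul (y : deg1) (A : grmod R) : grhom (gshift 1 A) A.
Proof.
refine (@mk_grhom R (gshift 1 A) A (fun x => sval y *: x) _ _).
  by move=> a x x'; rewrite scalerDr !scalerA mulrC.
move=> n x; rewrite shift_pieceE => Ax.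
by have := gm_act (svalP y) Ax; rewrite addrC subrK.
Defined.

Definition gcone0 (A B C : grmod R) (d : grhom A C) (h : grhom B C) :
  grhom (gdsum A B) C.
Proof.
refine (@mk_grhom R (gdsum A B) C (fun x => d x.1 + h x.2) _ _).
  by move=> a x y; rewrite !ghP scalerDr addrACA.
by move=> n x [Ax Bx]; apply: subgroupD; [exact: gm_subgroup | exact: gh_deg |
  exact: gh_deg].
Defined.

Definition gcone (A B C D : grmod R) (d : grhom A B) (h : grhom C B)
  (e : grhom C D) : grhom (gdsum A C) (gdsum B D).
Proof.
refine (@mk_grhom R (gdsum A C) (gdsum B D)
  (fun x => (d x.1 + h x.2, - e x.2)) _ _).
  move=> a x y; congr pair; first by rewrite !ghP /= scalerDr addrACA.
  by rewrite ghP opprD -scalerN /=.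
move=> n x [Ax Cx]; split.
  by apply: subgroupD; [exact: gm_subgroup | exact: gh_deg | exact: gh_deg].
by apply: subgroupN; [exact: gm_subgroup | exact: gh_deg].
Defined.

(* The Koszul complex of M on y :: l is the mapping cone of multiplication by y
   on the Koszul complex on l. *)
Fixpoint koszul_pos (l : seq deg1) (p : nat) : grmod R :=
  if l is y :: l' then
    gdsum (koszul_pos l' p)
      (gshift 1 (if p is p'.+1 then koszul_pos l' p' else M))
  else gsub (gzero M).

(** [koszul_pos l p] is the term of homological degree p + 1; degree 0 is kept apart so that it is
    [M] itself. *)
Definition koszul (l : seq deg1) (p : nat) : grmod R :=
  if p is p'.+1 then koszul_pos l p' else M.

Fixpoint koszul_dif (l : seq deg1) : forall p,
    grhom (koszul l p.+1) (koszul l p) :=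
  match l with
  | [::] => fun p => gzero_map (koszul [::] p.+1) (koszul [::] p)
  | y :: l' => fun p =>
    match p with
    | 0 => gcone0 (koszul_dif l' 0) (gmul y M)
    | p'.+1 => gcone (koszul_dif l' p'.+1) (gmul y (koszul l' p'.+1))
        (gshift_hom 1 (koszul_dif l' p'))
    end
  end.

Lemma koszul_dif0E y l (x : koszul (y :: l) 1) :
  koszul_dif (y :: l) 0 x = koszul_dif l 0 x.1 + sval y *: x.2.
Proof. by []. Qed.

Lemma koszul_difSE y l p (x : koszul (y :: l) p.+2) :
  koszul_dif (y :: l) p.+1 x =
  (koszul_dif l p.+1 x.1 + sval y *: x.2, - koszul_dif l p x.2).
Proof. by []. Qed.

Lemma koszul_nil p (x : koszul [::] p.+1) : x = 0.
Proof. by apply: val_inj; exact: (@sub_typeP _ _ (gzero M) x). Qed.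

Lemma koszul_dif_dif l p x : koszul_dif l p (koszul_dif l p.+1 x) = 0.
Proof.
elim: l p x => [|y l IH] p x //; rewrite koszul_difSE.
case: p x => [|p] x; first rewrite koszul_dif0E /=.
  by rewrite ghD IH add0r scalerN -ghZ subrr.
rewrite koszul_difSE /=; congr pair; last by rewrite ghN opprK IH.
by rewrite ghD IH add0r scalerN -ghZ subrr.
Qed.

Lemma koszul_large l p (x : koszul l p) : (size l < p)%N -> x = 0.
Proof.
elim: l p x => [|y l IH] [|p] // x lp; first exact: koszul_nil.
by case: x => a b; congr pair; [apply: IH (ltnW lp) | apply: (IH p b)].
Qed.

Lemma koszul_augmentation l (y : R) (x : M) : y \in [seq sval z | z <- l] ->
  exists w, koszul_dif l 0 w = y *: x.
Proof.
elim: l => [|z l IH] //=; rewrite inE => /orP [/eqP ->|/IH [w wE]].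
  by exists (0, x); rewrite [LHS]koszul_dif0E gh0 add0r.
by exists (w, 0); rewrite [LHS]koszul_dif0E scaler0 addr0.
Qed.

(* An element acts nilpotently on the homology of the cone of multiplication by
   z when it does so on the homology of the original complex, and z acts as 0. *)
Lemma koszul_homology l p (y : R) (x : koszul l p.+1) :
  y \in [seq sval z | z <- l] -> koszul_dif l p x = 0 ->
  exists k w, koszul_dif l p.+1 w = y ^+ k *: x.
Proof.
elim: l p y x => [|z l IH] p y //= [a b]; rewrite inE => yzl dx0.
have dab : koszul_dif l p a + sval z *: b = 0.
  by case: p a b dx0 => [|p] a b // [].
case/orP: yzl => [/eqP ->|yl].
  (* The boundary of (0, a) is (z a, - d a), and - d a = z b because (a, b) is a cycle. *)
  exists 1%N, (0, a); rewrite [LHS]koszul_difSE /= gh0 add0r expr1; congr pair.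
  by apply/eqP; rewrite eq_sym -addr_eq0 addrC dab.
have [k [v vE]] : exists k v, koszul_dif l p v = y ^+ k *: b.
  case: p a b dx0 {dab} => [|p] a b.
    by have [v vE] := koszul_augmentation b yl; exists 1%N, v; rewrite expr1.
  move=> [_ /eqP]; rewrite oppr_eq0 => /eqP; exact: IH.
(* This element is a cycle, as its boundary is y^k (d a + z b). Once y^m times it is the boundary of
   [u], the correction - y^m v in the second component cancels the term y^m z v. *)
have [|m [u uE]] := IH p y (y ^+ k *: a + sval z *: v) yl.
  by rewrite ghD !ghZ vE scalerA mulrC -scalerA -scalerDr dab scaler0.
exists (m + k)%N, (u, - (y ^+ m *: v)).
rewrite [LHS]koszul_difSE /= uE exprD ghN opprK ghZ vE -!scalerA; congr pair => //=.
by rewrite scalerN scalerDr (scalerA (sval z)) mulrC -(scalerA _ (sval z)) addrK.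
Qed.

Variable s : seq R.

Lemma koszul_vanishes l j p : (forall n, cohom_vanishes s j n M) ->
  forall n, cohom_vanishes s j n (koszul l p).
Proof.
move=> vM; elim: l p => [|y l IH] [|p] n //=.
  apply: injective_vanishes => A B i f inj_i.
  by exists (gzero_map B (gsub (gzero M))) => x; rewrite [RHS](@koszul_nil 0).
apply: vanishes_dsum; first exact: (IH p.+1).
by rewrite -[n](subrK 1); apply: vanishes_shift; apply: (IH p).
Qed.

(** Homological degree 1 is a sum of copies of M(-1), so its cohomology in degree n + 1 sees only
    that of M in degree n. This is the source of the step from n to n + 1. *)
Lemma koszul1_vanishes l j n : cohom_vanishes s j n M ->
  cohom_vanishes s j (n + 1) (koszul l 1).
Proof.
move=> vM; elim: l => [|y l IH].
  apply: injective_vanishes => A B i f inj_i.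
  by exists (gzero_map B (gsub (gzero M))) => x; rewrite [RHS](@koszul_nil 0).
by apply: vanishes_dsum => //; apply: vanishes_shift.
Qed.

End Koszul.

(** * Descent along the Koszul complex *)

Section TopCohomology.
Variables (R : noethGradedRing) (M : grmod R).
Variable l : seq {y : R | gr_piece R 1%N y}.
Variable j : nat.
Let s := [seq sval y | y <- l].
Let K p := koszul M l p.
Let d p := koszul_dif M l p.

Hypothesis vanish_above : forall j', (j < j')%N -> forall n,
  cohom_vanishes s j' n M.

Let s_deg1 g : g \in s -> gr_piece R 1%N g.
Proof.
rewrite /s; elim: (l) => [|y l' IH] //=; rewrite inE => /orP [/eqP ->|//].
exact: svalP.
Qed.

(** The cycles are an extension of the Koszul homology, which is torsion, by the boundaries I. *)
Let cycles_vanish p j' n I (q : grhom (K p.+2) I) (i : grhom I (K p.+1)) :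
  (forall c, exists b, q b = c) -> injective i -> (forall a, i (q a) = d p.+1 a) ->
  cohom_vanishes s j' n I -> cohom_vanishes s j' n (gsub (gker (d p))).
Proof.
move=> surj_q inj_i iq vI.
have inj_inc : injective (ginc (gker (d p))) by exact: val_inj.
have [|u uE] := @factor_mono _ _ _ I (ginc (gker (d p))) i inj_inc.
  move=> y; have [w <-] := surj_q y.
  have dw : gker (d p) (i (q w)) by rewrite /= iq; exact: koszul_dif_dif.
  by exists (to_sub dw).
have [|H [h uh]] := @coker_exact _ _ _ u.
  by move=> x y uxy; apply: inj_i; rewrite -!uE uxy.
have [_ ex_uh surj_h] := uh.
apply: (vanishes_mid uh) => //; apply: (torsion_module_vanishes s_deg1) => y g gs.
have [z <-] := surj_h y.
have [k [w wE]] := koszul_homology gs (@sub_typeP _ _ (gker (d p)) z).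
exists k; rewrite -ghZ; apply/ex_uh; exists (q w); apply: inj_inc.
by rewrite uE iq ghZ.
Qed.

(** Descending induction on p, with [m] bounding the distance to the end of the complex, beyond
    which the terms are zero. The boundaries are K (p+1) modulo cycles, so index j' for them needs
    index j' + 1 for the cycles; hence the quantification over all j' > j. *)
Let boundaries_vanish m p : (size l <= p + m)%N ->
  forall I (q : grhom (K p.+1) I) (i : grhom I (K p)),
  short_exact (ginc (gker (d p))) q -> injective i ->
  (forall a, i (q a) = d p a) ->
  forall j' n, (j < j')%N -> cohom_vanishes s j' n I.
Proof.
elim: m p => [|m IH] p lpm I q i kq inj_i iq j' n jj'.
  apply: (torsion_module_vanishes s_deg1) => y.
  have [_ _ /(_ y) [x <-]] := kq.
  rewrite (@koszul_large _ _ l p.+1 x) ?gh0; first exact: power_torsion0.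
  by rewrite ltnS -[p]addn0.
apply: (vanishes_right kq).
  by apply: koszul_vanishes => n'; apply: vanish_above.
have [I' [q' [i' [kq' inj_i' iq']]]] := grhom_image (d p.+1).
have [_ _ surj_q'] := kq'.
apply: (cycles_vanish surj_q' inj_i' iq').
by apply: (IH _ _ _ _ _ kq' inj_i' iq'); rewrite ?addSnnS // ltnW.
Qed.

(* This is the surjectivity of R_1 (x) H_n -> H_(n+1) for H = H^(j+1)(M). *)
Lemma top_vanishes_succ n :
  cohom_vanishes s j n M -> cohom_vanishes s j (n + 1) M.
Proof.
move=> vM; have [I [q [i [kq inj_i iq]]]] := grhom_image (d 0).
have [I' [q' [i' [kq' inj_i' iq']]]] := grhom_image (d 1).
have [_ _ surj_q'] := kq'.
have vI : cohom_vanishes s j (n + 1) I.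
  apply: (vanishes_right kq); first exact: koszul1_vanishes.
  apply: (cycles_vanish surj_q' inj_i' iq').
  exact: (boundaries_vanish (leq_addl 1 (size l)) kq' inj_i' iq').
(* I is the image (s)M, so C = M/(s)M is killed by [s] and has no higher cohomology. *)
have [C [p ip]] := coker_exact inj_i; have [_ ex_ip surj_p] := ip.
apply: (vanishes_mid ip) => //; apply: (torsion_module_vanishes s_deg1) => y g gs.
have [x <-] := surj_p y; have [w wE] := koszul_augmentation x gs.
by exists 1%N; rewrite -ghZ; apply/ex_ip; exists (q w); rewrite iq expr1.
Qed.

End TopCohomology.

(** * Torsion over a standard graded ring with local base *)

(** If 1 + y were not a unit, Zorn's lemma would give a maximal ideal containing it. This ideal must
    be [m], and then 1 = (1 + y) - y lies in [m]. *)
Lemma local_ring_unit (A : comNzRingType) (m : set A) y :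
  local_ring m -> m y -> exists w, w * (1 + y) = 1.
Proof.
move=> [[im m1 _] m_uniq] my; have [m0 mD mM] := im.
apply: contrapT => nu.
pose good (K : set A) := [/\ is_ideal K, K (1 + y) & ~ K 1].
have good0 : good [set a | exists w, a = w * (1 + y)].
  split; [split | by exists 1; rewrite mul1r | by move=> [w w1]; apply: nu; exists w].
  - by exists 0; rewrite mul0r.
  - by move=> _ _ [u ->] [v ->]; exists (u + v); rewrite mulrDl.
  - by move=> a _ [u ->]; exists (a * u); rewrite mulrA.
pose P (K : set A) := K = set0 \/ good K.
have [F FP totF|K [PK Kmax]] := @Zorn_bigcup _ P.
  have goodF K x : F K -> K x -> good K.
    by move=> FK Kx; case: (FP _ FK) => // K0; move: Kx; rewrite K0.
  have [[K0 [x0 [FK0 Kx0]]]|F0] := pselect (exists (K : set A) x, F K /\ K x);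
      last first.
    by left; rewrite -subset0 => x [K FK Kx]; apply: F0; exists K, x.
  have [[K00 _ _] K0y _] := goodF _ _ FK0 Kx0; right; split.
  - split; first by exists K0.
      move=> u v [K FK Ku] [K' FK' Kv]; have [KK|KK] := totF _ _ FK FK'.
        have [[_ KD _] _ _] := goodF _ _ FK' Kv.
        by exists K' => //; apply: KD => //; apply: KK.
      have [[_ KD _] _ _] := goodF _ _ FK Ku.
      by exists K => //; apply: KD => //; apply: KK.
    move=> a u [K FK Ku]; have [[_ _ KM] _ _] := goodF _ _ FK Ku.
    by exists K => //; apply: KM.
  - by exists K0.
  - by move=> [K FK K1]; have [_ _] := goodF _ _ FK K1.
have gdK : good K.
  case: PK => // K0; exfalso; apply: (Kmax _ _ (or_intror good0)).
  rewrite K0; split; first exact: sub0set.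
  by move=> /(_ (1 + y)); apply; exists 1; rewrite mul1r.
have [iK Ky K1] := gdK.
have ideal1 (I : set A) : is_ideal I -> I 1 -> I = setT.
  move=> [_ _ IM] I1; rewrite -subTset => x _.
  by rewrite -[x]mulr1; apply: IM.
have mK : maximal_ideal K.
  split=> //; first by move=> KT; apply: K1; rewrite KT.
  move=> I iI KI; have [I1|nI1] := pselect (I 1); first by right; apply: ideal1.
  left; apply: contrapT => IK; apply: (Kmax I); last by right; split=> //; apply: KI.
  by split=> // IK'; apply: IK; rewrite eqEsubset.
rewrite (m_uniq _ mK) in Ky; apply: m1; apply: ideal1 => //.
by rewrite -[1](addrK y); apply: (ideal_subgroup im).2.
Qed.

Section StandardGraded.
Variables (R : noethGradedRing) (s : seq R).
Hypothesis s_deg1 : forall g, g \in s -> gr_piece R 1%N g.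
Hypothesis s_gen : forall B : set R, gr_piece R 0%N `<=` B ->
  (forall x, x \in s -> B x) ->
  (forall x y, B x -> B y -> B (x + y) /\ B (x * y)) -> B = setT.

Let proj_axiom (p : nat -> {additive R -> R}) :=
  [/\ forall n x, gr_piece R n (p n x),
      forall n x, gr_piece R n x -> p n x = x,
      forall n m x, gr_piece R n x -> m != n -> p m x = 0 &
      forall x, exists2 s, uniq s & x = \sum_(n <- s) p n x].

Let proj_mul p k t a g : proj_axiom p -> gr_piece R t g ->
  p (k + t)%N (a * g) = p k a * g.
Proof.
move=> [pR pE p0 ps] Rg; have [u _ ->] := ps a.
rewrite mulr_suml !raddf_sum mulr_suml; apply: eq_bigr => n _ /=.
have Rn := gr_mul (pR n a) Rg; have [->|kn] := eqVneq k n.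
  by rewrite (pE _ _ Rn) (pE _ _ (pR n a)).
by rewrite (p0 _ _ _ Rn) ?eqn_add2r // (p0 _ _ _ (pR n a)) // mul0r.
Qed.

Let proj_scale p (N : grmod R) (q : int -> {additive N -> N}) k n b x :
  proj_axiom p ->
  (forall n x, gm_piece N n x -> q n x = x) ->
  (forall n m x, gm_piece N n x -> m != n -> q m x = 0) ->
  gm_piece N n x -> q (k%:Z + n) (b *: x) = p k b *: x.
Proof.
move=> [pR pE p0 ps] qE q0 Nx; have [u _ ->] := ps b.
rewrite scaler_suml !raddf_sum scaler_suml; apply: eq_bigr => m _ /=.
have Nm := gm_act (pR m b) Nx; have [->|km] := eqVneq k m.
  by rewrite (qE _ _ Nm) (pE _ _ (pR m b)).
rewrite (q0 _ _ _ Nm) ?(p0 _ _ _ (pR m b)) ?scale0r //.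
by rewrite (inj_eq (addIr _)).
Qed.

Let proj0_deg1 p a g : proj_axiom p -> gr_piece R 1%N g -> p 0%N (a * g) = 0.
Proof.
move=> [pR pE p0 ps] Rg; have [u _ ->] := ps a.
rewrite mulr_suml raddf_sum big1 // => n _.
by rewrite (p0 _ _ _ (gr_mul (pR n a) Rg)) // addn1.
Qed.

Let irrelevant_piece k r : gr_piece R k.+1 r -> hi_set (irrelevant R) r.
Proof.
move=> Rr; apply: (@homsum1 _ _ _ k.+1) => // n.
split; first by split=> //; apply: (gr_subgroup R n).1.
move=> u v [Ru u0] [Rv v0]; split; first exact: (gr_subgroup R n).2.
by move=> n0; rewrite u0 // v0 // subrr.
Qed.

(** The elements congruent to an element of R_0 modulo (s) form a subalgebra containing [s], hence
    all of R. For x in R_+ that element of R_0 is 0, as both R_+ and (s) have zero degree 0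
    component. *)
Lemma irrelevant_gen : hi_set (irrelevant R) = ideal_gen [set g | g \in s].
Proof.
have [p pP] := direct_sum_proj_additive (gr_sum R); have [pR pE p0 ps] := pP.
set I := ideal_gen _; have iI : is_ideal I by exact: ideal_gen_ideal.
have [I0 ID IM] := iI; have gR := gr_subgroup R.
have I_p0 y : I y -> p 0%N y = 0.
  (* A generated ideal is an intersection of ideals, so the property is strengthened by a multiplier
     [a] until it defines an ideal. The same device recurs below. *)
  move=> Iy; have : forall a, p 0%N (a * y) = 0; last by move=> /(_ 1); rewrite mul1r.
  apply: (Iy [set y | forall a, p 0%N (a * y) = 0]); last first.
    by move=> g /= gs a; apply: proj0_deg1 => //; apply: s_deg1.
  split=> /= [a|x z x0 z0 a|b x x0 a]; first by rewrite mulr0 raddf0.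
    by rewrite mulrDr raddfD /= x0 z0 addr0.
  by rewrite mulrA.
rewrite eqEsubset; split=> x.
- move=> Ix.
  have px : p 0%N x = 0.
    move: Ix => [t [f [_ Rf ->]]]; rewrite raddf_sum big1 // => n _ /=.
    have [Rn f0] := Rf n; have [n0|n0] := eqVneq n 0%N; first by rewrite f0 ?raddf0.
    by rewrite (p0 _ _ _ Rn) // eq_sym.
  have : [set r | exists2 a, gr_piece R 0%N a & I (r - a)] = setT.
    apply: s_gen.
    + by move=> r Rr; exists r; rewrite ?subrr.
    + move=> g gs; exists 0; first exact: (gR 0%N).1.
      by rewrite subr0; apply: sub_ideal_gen.
    + move=> r r' [a Ra Ir] [a' Ra' Ir']; split.
        exists (a + a'); first exact: subgroupD.
        by rewrite opprD addrACA; apply: ID.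
      exists (a * a'); first exact: (gr_mul Ra Ra').
      have -> : r * r' - a * a' = r * (r' - a') + a' * (r - a).
        by rewrite !mulrBr [a' * r]mulrC [a' * a]mulrC addrA subrK.
      by apply: ID; apply: IM.
  move=> /(congr1 (@^~ x)) /= xB.
  have [a Ra Ixa] : exists2 a, gr_piece R 0%N a & I (x - a) by rewrite xB.
  have := I_p0 _ Ixa; rewrite raddfB /= px pE // sub0r => /eqP.
  by rewrite oppr_eq0 => /eqP a0; move: Ixa; rewrite a0 subr0.
- apply; first exact: irrelevant_is_ideal.
  by move=> g gs; apply: (irrelevant_piece (s_deg1 gs)).
Qed.

Let base_submod (B : set R) :=
  is_subgroup B /\ forall a x, gr_piece R 0%N a -> B x -> B (a * x).

(** [t] lists the k-fold products of elements of [s]. That they generate R_k over R_0 is phrased as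
    an induction principle on R_0-submodules, which avoids handling coefficients. *)
Let piece_gen k : exists t : seq R,
  (forall u, u \in t -> gr_piece R k u /\ ideal_exp (irrelevant R) k u) /\
  forall B, base_submod B -> (forall u, u \in t -> B u) -> gr_piece R k `<=` B.
Proof.
have [p pP] := direct_sum_proj_additive (gr_sum R); have [pR pE p0 ps] := pP.
elim: k => [|k [t [tR tB]]].
  exists [:: 1]; split=> [u|B [gB BM] Bt r Rr].
    by rewrite inE => /eqP ->; split=> //; exact: gr_one.
  by rewrite -[r]mulr1; apply: BM => //; apply: Bt; rewrite inE.
exists [seq g * u | g <- s, u <- t]; split=> [_ /allpairsP [[g u] [/= gs ut ->]]|].
  have [Ru Iu] := tR u ut; split.
    by rewrite -add1n; apply: gr_mul => //; apply: s_deg1.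
  apply: ideal_expS => //.
  by rewrite -[X in X g]/(hi_set (irrelevant R)) irrelevant_gen; apply: sub_ideal_gen.
move=> B [gB BM] Bt.
have Bs g c : g \in s -> gr_piece R k c -> B (c * g).
  move=> gs; apply: (tB [set c | B (c * g)]).
    split=> [|a x Ra Bx]; last by rewrite /= -mulrA; apply: BM.
    split; first by rewrite /= mul0r; exact: gB.1.
    by move=> x y Bx By; rewrite /= mulrBl; apply: gB.2.
  by move=> u ut; rewrite /= mulrC; apply: Bt; apply/allpairsP; exists (g, u).
move=> r Rr; have Ir := irrelevant_piece Rr; rewrite irrelevant_gen in Ir.
have : forall a, B (p k.+1 (a * r)); last by move=> /(_ 1); rewrite mul1r pE.
apply: (Ir [set r | forall a, B (p k.+1 (a * r))]).
  split=> /= [a|x y Bx By a|b x Bx a]; last by rewrite mulrA.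
    by rewrite mulr0 raddf0; exact: gB.1.
  by rewrite mulrDr raddfD; apply: subgroupD.
move=> g gs a /=; rewrite -addn1 (proj_mul _ _ pP (s_deg1 gs)).
exact: Bs.
Qed.

Variable m0 : set (base_ring R).
Hypothesis m0_local : local_ring m0.

(** Nakayama's lemma takes the form of a determinant argument over R: the generators [y i] of R_k x
    satisfy a linear system whose matrix is congruent to 1 modulo m0 R. Its determinant kills them
    but need not be a unit; its degree 0 component is one, and still kills the [y i] because they
    are homogeneous. *)
Lemma homogeneous_torsion (N : grmod R) n (x : N) : gm_piece N n x ->
  torsion (irrelevant R) (ext_ideal m0) N x <-> power_torsion s x.
Proof.
move=> Nx; split; last first.
  move=> tx; have iK : is_ideal [set a : R | a *: x = 0].
    split=> [|a b ax bx|a b bx] /=; first by rewrite scale0r.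
      by rewrite scalerDl ax bx addr0.
    by rewrite -scalerA bx scaler0.
  have [k Hk] := @fg_radical_exp _ s _ iK tx.
  exists k => m km a Ia; exists 0; first by case: (hi_ideal (ext_ideal m0)).
  by rewrite scale0r; apply: Hk; rewrite -irrelevant_gen; apply: ideal_exp_decr Ia.
have [p pP] := direct_sum_proj_additive (gr_sum R); have [pR pE p0 ps] := pP.
have [q [qN qE q0 qs]] := gm_proj N.
move=> [k /(_ _ (leqnn k)) tk]; have [t [tR tB]] := piece_gen k.
set J := ext_ideal m0 in tk; have iJ := hi_ideal J; have [J0 JD JM] := iJ.
have gJ := ideal_subgroup iJ.
pose y (i : 'I_(size t)) := t`_i *: x.
pose S z := exists2 c : 'I_(size t) -> R, forall i, J (c i) &
  z = \sum_i c i *: y i.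
have gS : is_subgroup S.
  split; first by exists (fun=> 0) => //; rewrite big1 // => i _; rewrite scale0r.
  move=> _ _ [c Jc ->] [c' Jc' ->]; exists (fun i => c i - c' i).
    by move=> i; apply: gJ.2.
  by rewrite -sumrB; apply: eq_bigr => i _; rewrite scalerBl.
(* For a generator w of m0 R, the degree k component of a w is w times that of [a], and the latter
   carries [x] into the R_0-span of the [y i]. *)
have JS b : J b -> S (p k b *: x).
  move=> Jb; have : forall a, S (p k (a * b) *: x); last by move=> /(_ 1); rewrite mul1r.
  apply: (Jb [set b | forall a, S (p k (a * b) *: x)]).
    split=> /= [a|u v Su Sv a|b' u Su a]; last by rewrite mulrA.
      by rewrite mulr0 raddf0 scale0r; exact: gS.1.
    by rewrite mulrDr raddfD scalerDl; apply: subgroupD.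
  move=> _ [w mw <-] a /=.
  have R0w : gr_piece R 0%N (val w) by apply/asboolP; exact: (valP w).
  have Jw : J (val w) by apply: sub_ideal_gen; exists w.
  rewrite -[k]addn0 (proj_mul _ _ pP R0w) mulrC.
  apply: (tB [set r | S ((val w * r) *: x)]) (pR k a); first split.
  - split; first by rewrite /= mulr0 scale0r; exact: gS.1.
    by move=> u v Su Sv; rewrite /= mulrBr scalerBl; apply: gS.2.
  - move=> b' u Rb [c Jc cE]; exists (fun i => b' * c i).
      by move=> i; apply: JM.
    rewrite mulrCA -scalerA cE scaler_sumr.
    by apply: eq_bigr => i _; rewrite scalerA.
  - move=> u ut /=; have lu : (index u t < size t)%N by rewrite index_mem.
    exists (fun i => if i == Ordinal lu then val w else 0).
      by move=> i; case: ifP.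
    rewrite (bigD1 (Ordinal lu)) //= eqxx big1 ?addr0.
      by rewrite /y /= nth_index // scalerA.
    by move=> i /negPf ->; rewrite scale0r.
have yS i : S (y i).
  have ti : t`_i \in t by apply: mem_nth.
  have [Rt It] := tR _ ti; have [b Jb tb] := tk _ It.
  rewrite /y -(qE (k%:Z + n) (t`_i *: x)); last exact: gm_act.
  by rewrite tb (proj_scale _ _ pP qE q0 Nx); apply: JS.
pose c i := projT1 (cid2 (yS i)).
have Jc i l : J (c i l) by rewrite /c; case: cid2 => /= c' /(_ l).
have yE i : y i = \sum_l c i l *: y l by rewrite /c; case: cid2.
pose C : 'M[R]_(size t) := 1%:M - \matrix_(i, l) c i l.
have Cy i : \sum_l C i l *: y l = 0.
  under eq_bigr do rewrite !mxE scalerBl.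
  rewrite sumrB -yE (bigD1 i) //= eqxx scale1r big1 ?addr0 ?subrr // => l li.
  by rewrite eq_sym (negPf li) scale0r.
have detC l : \det C *: y l = 0.
  have -> : \det C *: y l = \sum_m (\adj C *m C) l m *: y m.
    rewrite mul_adj_mx (bigD1 l) //= mxE eqxx mulr1n big1 ?addr0 // => m ml.
    by rewrite mxE eq_sym (negPf ml) mulr0n scale0r.
  under eq_bigr do rewrite mxE scaler_suml.
  rewrite exchange_big big1 // => i _ /=.
  under eq_bigr do rewrite -scalerA.
  by rewrite -scaler_sumr Cy scaler0.
have Jdet : J (\det C - 1).
  rewrite -[X in _ - X](det1 R (size t)); apply: det_congr => // i l.
  by rewrite !mxE addrAC subrr sub0r; apply: (subgroupN gJ); apply: Jc.
have [w mw wE] : exists2 w, m0 w & val w = p 0%N (\det C - 1).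
  have [[im _ _] _] := m0_local; have [m00 mD mM] := im.
  have : forall a, exists2 w, m0 w & val w = p 0%N (a * (\det C - 1)); last first.
    by move=> /(_ 1); rewrite mul1r.
  apply: (Jdet [set b | forall a, exists2 w, m0 w & val w = p 0%N (a * b)]).
    split=> /= [a|u v mu mv a|b' u mu a]; last by rewrite mulrA.
      by exists 0; rewrite // mulr0 raddf0.
    have [w mw wE] := mu a; have [w' mw' wE'] := mv a.
    by exists (w + w'); [apply: mD | rewrite mulrDr raddfD /= -wE -wE'].
  move=> _ [w mw <-] a /=.
  have R0w : gr_piece R 0%N (val w) by apply/asboolP; exact: (valP w).
  have R0a : base_pred (p 0%N a) by apply/asboolP.
  pose v : base_ring R := exist _ (p 0%N a) R0a.
  exists (v * w); first exact: mM.
  by rewrite -[in RHS](addn0 0%N) (proj_mul _ _ pP R0w).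
have [w' w'w] := local_ring_unit m0_local mw.
have y0 i : y i = 0.
  have Ny : gm_piece N (k%:Z + n) (y i).
    by apply: gm_act => //; have [] := tR t`_i (mem_nth _ (ltn_ord i)).
  have pdet : p 0%N (\det C) = val (1 + w).
    rewrite -[\det C](subrK 1) raddfD /= -wE pE; last exact: gr_one.
    by rewrite addrC.
  have : p 0%N (\det C) *: y i = 0.
    by rewrite -(proj_scale _ _ pP qE q0 Ny) detC raddf0.
  move=> /(congr1 (fun z => val w' *: z)).
  rewrite scaler0 scalerA pdet.
  have -> : val w' * val (1 + w) = 1 by rewrite -[LHS]/(val (w' * (1 + w))) w'w.
  by rewrite scale1r.
move=> g gs; exists k; move: (expr_deg1 s_deg1 k gs).
apply: (tB [set r | r *: x = 0]); first split.
- split; first by rewrite /= scale0r.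
  by move=> u v /= u0 v0; rewrite scalerBl u0 v0 subrr.
- by move=> a u _ /= u0; rewrite -scalerA u0 scaler0.
- move=> u ut /=; have lu : (index u t < size t)%N by rewrite index_mem.
  by have := y0 (Ordinal lu); rewrite /y /= nth_index.
Qed.

End StandardGraded.

(** * Comparison with the chosen injective resolution *)

Lemma gcohom_piece0 (R : noethGradedRing) (B C : grmod R) (g : grhom B C)
    (S : hsubmod B) n :
  gm_piece (gcohom g S) n = [set 0] <->
  forall x, gm_piece B n x -> g x = 0 -> S x.
Proof.
split=> [H0 x Bx gx|HS].
  have kx : gker g x by [].
  have : gm_piece (gcohom g S) n (quot_pi _ (to_sub kx)) by exists (to_sub kx).
  rewrite H0 => /= xE; suff : gpre (ginc (gker g)) S (to_sub kx) by [].
  by rewrite -[X in sm_set _ X]subr0; apply/quot_piE; rewrite xE raddf0.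
rewrite eqEsubset; split=> [_ [z Bz <-]|_ ->]; last exact: (gm_subgroup _ n).1.
rewrite /= -[RHS](raddf0 (quot_pi _)); apply/quot_piE; rewrite subr0.
exact: HS Bz (@sub_typeP _ _ (gker g) z).
Qed.

Section Resolution.
Variables (R : noethGradedRing) (s : seq R) (N : grmod R).
Variable E : gr_injective_resolution N.

(** This is H^(m+1)(N)_n = 0 computed from the resolution, with the index convention of
    [cohom_vanishes]. *)
Let exact_at n m := forall x : E m.+1, gm_piece (E m.+1) n x ->
  power_torsion s x -> res_dif E m.+1 x = 0 ->
  exists y, [/\ gm_piece (E m) n y, power_torsion s y & res_dif E m y = x].

Let dif_dif m x : res_dif E m.+1 (res_dif E m x) = 0.
Proof. by apply/res_exactS; exists x. Qed.

(** Z is the m-th syzygy, so its H^(j+1) is H^(m+j+1) of N. The image of the m-th differential is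
    both the cokernel of Z in [E m] and the next syzygy, which lets the induction trade one unit of
    j for one of m. *)
Let syzygy_vanishes j : forall m n (Z : grmod R) (i : grhom Z (E m)),
  injective i -> (forall x, res_dif E m x = 0 <-> exists z, i z = x) ->
  cohom_vanishes s j n Z <-> exact_at n (m + j)%N.
Proof.
elim: j => [|j IH] m n Z i inj_i ex_i;
  have [I [q [k [[_ ex_q surj_q] inj_k kq]]]] := grhom_image (res_dif E m).
  all: have iq : short_exact i q by split=> // x; rewrite -ex_i -kq;
    split=> [->|]; rewrite ?gh0 // -[X in _ = X](gh0 k) => /inj_k.
- rewrite addn0; split=> [vZ x Ex tx dx|exE].
    have /res_exactS [y yx] := dx; rewrite -kq in yx.
    have [||b [Eb tb qb]] := vZ _ _ _ _ iq (q y).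
    + by apply: (grhom_reflects_piece inj_k); rewrite yx.
    + by apply: (power_torsion_inj inj_k); rewrite yx.
    by exists b; split=> //; rewrite -kq qb.
  apply: (torsion_lifts_test (@res_injective _ _ E m) iq) => c Ic tc.
  have [|y [Ey ty yc]] := exE _ (gh_deg k Ic) (power_torsion_hom k tc).
    by have [a <-] := surj_q c; rewrite kq; exact: dif_dif.
  by exists y; split=> //; apply: inj_k; rewrite kq.
- rewrite addnS -addSn -(IH _ n I k inj_k); last first.
    move=> x; rewrite res_exactS; split=> [[y <-]|[z <-]].
      by exists (q y); rewrite kq.
    by have [y <-] := surj_q z; exists y; rewrite kq.
  exact: (vanishes_one_injective s j n (@res_injective _ _ E m) iq).
Qed.

Lemma resolution_vanishes j n : cohom_vanishes s j n N <-> exact_at n j.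
Proof.
exact: (@syzygy_vanishes j 0%N n N (res_aug E) (@res_aug_inj _ _ E) (@res_exact0 _ _ E)).
Qed.
End Resolution.

Section LocalCohomology.
Variables (R : noethGradedRing) (s : seq R) (I J : hideal R).
Hypothesis torsionE : forall (N : grmod R) n (x : N), gm_piece N n x ->
  torsion I J N x <-> power_torsion s x.

Lemma local_cohom_vanishes j n (N : grmod R) :
  gm_piece (local_cohom I J j.+1 N) n = [set 0] <-> cohom_vanishes s j n N.
Proof.
set E := gr_resolution N; rewrite (resolution_vanishes s E) gcohom_piece0.
split=> [H x Ex tx dx|H x Ex dx].
  have Tx : gtorsion_sub I J (E j.+1) x by apply/(torsionE Ex).
  have [|y _ yx] := H (to_sub Tx) Ex.
    by apply: val_inj.
  have [p pP] := gm_proj (E j); have [pE p1 p0 _] := pP.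
  have [p' [_ p1' p0' _]] := gm_proj (E j.+1).
  have Ty := hs_proj n p1 p0 (@sub_typeP _ _ (gtorsion_sub I J (E j)) y).
  (* The preimage [y] need not be homogeneous, while the two notions of torsion are compared on
     homogeneous elements only; its degree n component has the same image [x]. *)
  exists (p n (val y)); split=> //; first exact/(torsionE (pE n (val y))).
  rewrite (grhom_proj _ n pP p1' p0') -[res_dif _ _ _]/(val (gtorsion_map I J (res_dif E j) y)).
  by rewrite yx /= p1'.
have Ex' : gm_piece (E j.+1) n (val x) by exact: Ex.
have [|y [Ey ty yx]] := H (val x) Ex' _ (congr1 val dx).
  by apply/(torsionE Ex'); exact: (@sub_typeP _ _ (gtorsion_sub I J (E j.+1)) x).
have Ty : gtorsion_sub I J (E j) y by apply/(torsionE Ey).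
by exists (to_sub Ty) => //; apply: val_inj.
Qed.
End LocalCohomology.

(** * Boundedness below and tameness *)

Lemma fin_gen_bounded_below (R : noethGradedRing) (M : grmod R) : fin_gen M ->
  exists n0, forall n, n <= n0 -> gm_piece M n `<=` [set 0].
Proof.
move=> [t tM]; have [p pP] := gm_proj M; have [pM pE p0 ps] := pP.
have bounded x : exists n0, forall n, n <= n0 -> p n x = 0.
  have [u _ ->] := ps x; elim: u => [|m u [n0 IH]].
    by exists 0 => n _; rewrite big_nil raddf0.
  exists (Num.min n0 (m - 1)) => n; rewrite le_min => /andP [nn0 nm].
  rewrite big_cons raddfD /= IH // addr0; apply: (p0 _ _ _ (pM m x)).
  by apply: contraTneq nm => ->; rewrite -ltNge ltrBlDr ltrDl.
have [n0 Hn0] : exists n0, forall x, x \in t -> forall n, n <= n0 -> p n x = 0.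
  elim: (t) => [|x u [n0 IH]]; first by exists 0.
  have [m Hm] := bounded x; exists (Num.min n0 m) => y; rewrite inE.
  move=> /orP [/eqP ->|yu] n; rewrite le_min => /andP [nn0 nm]; first exact: Hm.
  exact: IH.
exists n0 => n nn0 x Mx; rewrite /= -(pE n x Mx).
have [a ->] := tM x; rewrite raddf_sum big1 // => i _ /=.
have [_ /(_ (a i)) [u [f [_ Rf ->]]] _] := gr_sum R.
rewrite scaler_suml raddf_sum big1 // => k _ /=.
(* A coefficient of degree k >= 0 reaches degree n from degree n - k <= n0, where the generators
   have no component. *)
rewrite -[n](subrKC k%:Z) (gm_proj_scale _ _ pP (Rf k)).
rewrite Hn0 ?scaler0 //; first exact: mem_nth.
by rewrite (le_trans _ nn0) // lerBlDr lerDl.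
Qed.

Theorem corollary4p4 (R : noethGradedRing) (m0 : set (base_ring R))
  (M : grmod R) (c : nat)
  (R_std : standard_graded R)
  (m0_local : local_ring m0)
  (M_fg : fin_gen M)
  (c_cd : is_cd (irrelevant R) (ext_ideal m0) M c)
  (ab : (forall N : grmod R, fin_gen N -> forall k : nat,
           exists n0 : int, forall n : int, n0 <= n ->
             gm_piece (local_cohom (irrelevant R) (ext_ideal m0) k N) n
             = [set 0])
        \/
        (forall N : grmod R, fin_gen N -> forall (k : nat) (n : int),
           fin_gen_piece (local_cohom (irrelevant R) (ext_ideal m0) k N) n)) :
  tame (local_cohom (irrelevant R) (ext_ideal m0) c M).
Proof.
case: c c_cd => [|j] [_ c_max].
  have [n0 Hn0] := fin_gen_bounded_below M_fg; left; exists n0 => n nn0.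
  apply/gcohom_piece0 => x Ex /(congr1 val) /= /res_exact0 [y yx].
  have y0 : y = 0.
    apply: (Hn0 n nn0); apply: (grhom_reflects_piece (@res_aug_inj _ _ (gr_resolution M))).
    by rewrite yx; exact: Ex.
  by apply: val_inj; rewrite /= -yx y0 gh0.
have [s [s_deg1 s_gen]] := R_std.
have [l sE] : exists l : seq {y : R | gr_piece R 1%N y}, s = [seq sval y | y <- l].
  elim: (s) s_deg1 => [|g t IH] t1; first by exists [::].
  have [|l ->] := IH; first by move=> x xt; apply: t1; rewrite inE xt orbT.
  by exists (exist _ g (t1 g (mem_head _ _)) :: l).
have HE := local_cohom_vanishes (homogeneous_torsion s_deg1 s_gen m0_local).
have above j' : (j < j')%N -> forall n, cohom_vanishes s j' n M.
  move=> jj' n; apply/HE; rewrite eqEsubset; split=> [x _|_ ->]; last first.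
    exact: (gm_subgroup _ n).1.
  apply: contrapT => x0; have := c_max j'.+1 (ex_intro _ x x0).
  by rewrite ltnS leqNgt jj'.
rewrite sE in HE above.
have succ n (k : nat) :
    gm_piece (local_cohom (irrelevant R) (ext_ideal m0) j.+1 M) n = [set 0] ->
    gm_piece (local_cohom (irrelevant R) (ext_ideal m0) j.+1 M) (n + k%:Z) = [set 0].
  rewrite !HE => vM; elim: k => [|k IH]; first by rewrite addr0.
  by rewrite intS [1 + _]addrC addrA; apply: top_vanishes_succ.
have [all0|] := pselect (forall n,
    gm_piece (local_cohom (irrelevant R) (ext_ideal m0) j.+1 M) n = [set 0]).
  by left; exists 0 => n _.
(* Vanishing in a degree n <= n0 would climb by unit steps up to n0, where the component is
   nonzero. *)
move=> /existsNP [n0 nz]; right; exists n0 => n nn0 n_0; apply: nz.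
have := succ n `|n0 - n|%N n_0.
by rewrite gez0_abs ?subr_ge0 // subrKC.
Qed.
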